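(* The set of Borel codes of equivalence relations on Cantor space $2^\omega$ that are $\boldsymbol{\Pi}^0_2$ and learnable is $\boldsymbol{\Pi}^1_1$-complete (with respect to Wadge reducibility).
   Context: A Borel code is a labeled tree $T\subseteq\omega^{<\omega}$ whose leaves are labeled by codes for elements of a fixed countable subbase of $2^\omega\times 2^\omega$ and whose internal nodes are labeled by $\cup$ or $\cap$; labeled trees are identified with elements of $2^\omega$. An equivalence relation $E$ on $2^\omega$ is learnable if there are continuous functions $l_n:(2^\omega)^\omega\times 2^\omega\to\omega$ ($\omega$ discrete) such that for all $x$ and $\vec x=(x_i)_{i\in\omega}$, if $x\mathrel{E}x_i$ for some $i$, then $L=\lim_n l_n(\vec x,x)$ exists and $x\mathrel{E}x_L$. For $A\subseteq X$, $B\subseteq Y$ ($X,Y$ Polish), $A\le_W B$ if there is a continuous $f:X\to Y$ with $x\in A\iff f(x)\in B$; $A$ is $\boldsymbol{\Pi}^1_1$-complete if $A\in\boldsymbol{\Pi}^1_1$ and every $\boldsymbol{\Pi}^1_1$ set (in a Polish space) Wadge reduces to $A$.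
   Formalization: Completeness is tested on Π¹₁ subsets of zero-dimensional Polish spaces only, since {0} in the real line reduces continuously to no subset of Cantor space; Borel codes are taken to be nonempty well-founded trees. *)

(* Defs.v *)
From HB Require Import structures.
From mathcomp Require Import all_boot all_order all_algebra.
From mathcomp Require Import all_classical all_reals.
From mathcomp Require Import topology sequences cantor borel_hierarchy.

Set Implicit Arguments.
Unset Strict Implicit.
Unset Printing Implicit Defensive.

Import Order.TTheory GRing.Theory Num.Theory.

Local Open Scope classical_set_scope.

(** ** Polish spaces *)

Definition is_metric (R : realType) (T : Type) (d : T -> T -> R) : Prop :=
  [/\ forall x y, (0 <= d x y)%R,
      forall x y, d x y = 0%R <-> x = y,
      forall x y, d x y = d y x &
      forall x y z, (d x z <= d x y + d y z)%R].

Definition metrizes (R : realType) (T : topologicalType) (d : T -> T -> R) :=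
  forall (x : T) (U : set T),
    nbhs x U <-> exists2 e : R, (0 < e)%R & [set y | (d x y < e)%R] `<=` U.

Definition complete_metric (R : realType) (T : topologicalType)
    (d : T -> T -> R) :=
  forall u : nat -> T,
    (forall e : R, (0 < e)%R ->
       exists N : nat, forall m n : nat, N <= m -> N <= n ->
         (d (u m) (u n) < e)%R) ->
    exists l : T, u @ \oo --> l.

Definition polish (R : realType) (T : topologicalType) : Prop :=
  (exists2 D : set T, countable D & dense D) /\
  (exists d : T -> T -> R,
     [/\ is_metric d, metrizes d & complete_metric d]).

(* The library's [zero_dimensional] only says that distinct points are
   separated by clopen sets; a base of clopen sets is a stronger condition on
   non-compact spaces. *)
Definition has_clopen_base (T : topologicalType) : Prop := basis (@clopen T).

(** ** Projective classes and Wadge reducibility *)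

Definition baire_space : Type := prod_topology (fun _ : nat => nat).
HB.instance Definition _ := Pointed.on baire_space.
HB.instance Definition _ := Nbhs.on baire_space.
HB.instance Definition _ := Topological.on baire_space.
HB.instance Definition _ := Uniform.on baire_space.

Definition Sigma11 (X : topologicalType) (A : set X) : Prop :=
  exists2 C : set (X * baire_space), closed C & A = fst @` C.

Definition Pi11 (X : topologicalType) (A : set X) : Prop := Sigma11 (~` A).

Definition wadge_le (X Y : topologicalType) (A : set X) (B : set Y) : Prop :=
  exists2 f : X -> Y, continuous f & forall x, A x <-> B (f x).

(* Hardness is tested on zero-dimensional Polish spaces, as is standard: a
   continuous map from a connected space such as the real line to Cantor space
   is constant, so no subset of Cantor space is hard for all Polish spaces. *)
Definition Pi11_complete (R : realType) (Y : topologicalType) (A : set Y) :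
    Prop :=
  Pi11 A /\
  forall X : topologicalType, polish R X -> has_clopen_base X ->
    forall B : set X, Pi11 B -> wadge_le B A.

(** ** Learnable equivalence relations *)

Definition equivalence_relation (T : Type) (E : T -> T -> Prop) : Prop :=
  [/\ forall x, E x x,
      forall x y, E x y -> E y x &
      forall x y z, E x y -> E y z -> E x z].

Definition cantor_seq : Type := prod_topology (fun _ : nat => cantor_space).
HB.instance Definition _ := Pointed.on cantor_seq.
HB.instance Definition _ := Nbhs.on cantor_seq.
HB.instance Definition _ := Topological.on cantor_seq.
HB.instance Definition _ := Uniform.on cantor_seq.

(* The topology of [nat] in the library is the discrete one. *)
Definition learnable (E : cantor_space -> cantor_space -> Prop) : Prop :=
  exists2 l : nat -> cantor_seq * cantor_space -> nat,
    forall n, continuous (l n) &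
    forall (x : cantor_space) (xs : cantor_seq),
      (exists i, E x (xs i)) ->
      exists2 L : nat, l n (xs, x) @[n --> \oo] --> L & E x (xs L).

(** ** Borel codes *)

Inductive label : Type := Cup | Cap | Basic of nat.

(* A labeled tree is the partial function mapping each of its nodes to its
   label; the nodes are the sequences with value different from [None], and the
   children of [s] are the nodes of the form [rcons s n]. *)
Definition labeled_tree : Type := seq nat -> option label.

Definition node (t : labeled_tree) (s : seq nat) : Prop := t s <> None.

Definition has_child (t : labeled_tree) (s : seq nat) : Prop :=
  exists n, node t (rcons s n).

Definition is_tree (t : labeled_tree) : Prop :=
  node t [::] /\ forall s n, node t (rcons s n) -> node t s.

Definition well_labeled (t : labeled_tree) : Prop :=
  forall s a, t s = Some a -> has_child t s <-> (a = Cup \/ a = Cap).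

Definition well_founded_tree (t : labeled_tree) : Prop :=
  ~ exists f : nat -> nat, forall n, node t (mkseq f n).

Definition borel_tree (t : labeled_tree) : Prop :=
  [/\ is_tree t, well_labeled t & well_founded_tree t].

Definition subbase (X : topologicalType) (B : nat -> set X) : Prop :=
  basis (finI_from [set: nat] B).

(* [node_set B t s p]: p belongs to the set attached to the node s of t. On a
   well-founded tree the least solution taken here is the only one, and it is
   the set obtained by recursion from the leaves. *)
Inductive node_set (X : Type) (B : nat -> set X) (t : labeled_tree) :
    seq nat -> X -> Prop :=
| node_set_basic s k p : t s = Some (Basic k) -> B k p -> node_set B t s p
| node_set_cup s n p : t s = Some Cup ->
    node t (rcons s n) -> node_set B t (rcons s n) p -> node_set B t s p
| node_set_cap s p : t s = Some Cap ->
    (forall n, node t (rcons s n) -> node_set B t (rcons s n) p) ->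
    node_set B t s p.

Definition coded_set (X : Type) (B : nat -> set X) (t : labeled_tree) : set X :=
  [set p | node_set B t [::] p].

Definition label_index (a : label) : nat :=
  match a with Cup => 0 | Cap => 1 | Basic k => k.+2 end.

(* [CodeSeq.code] is a bijection from [seq nat] to [nat] sending the empty
   sequence to 0, hence this is a bijection from [seq nat * label] to [nat]. *)
Definition entry_index (s : seq nat) (a : label) : nat :=
  (CodeSeq.code (label_index a :: s)).-1.

Lemma entry_index_bij :
  bijective (fun p : seq nat * label => entry_index p.1 p.2).
Proof.
pose unlabel n := match n with 0 => Cup | 1 => Cap | k.+2 => Basic k end.
pose g n := let s := CodeSeq.decode n.+1 in (behead s, unlabel (head 0 s)).
have code_gt0 n s : 0 < CodeSeq.code (n :: s).
  by rewrite /= muln_gt0 expn_gt0.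
exists g.
  case=> s a; rewrite /g /entry_index prednK // CodeSeq.codeK /=.
  by case: a.
move=> n; rewrite /g /entry_index.
have := CodeSeq.decodeK n.+1; case: (CodeSeq.decode n.+1) => [//|k s] def_n.
suff -> : label_index (unlabel k) = k by rewrite [behead _]/= def_n.
by case: k {def_n} => [|[|k]].
Qed.

(* The point of Cantor space identified with t: the characteristic function of
   the graph of t. *)
Definition codes_tree (c : cantor_space) (t : labeled_tree) : Prop :=
  forall s a, c (entry_index s a) = true <-> t s = Some a.

Definition Pi02_learnable_codes (B : nat -> set (cantor_space * cantor_space)) :
    set cantor_space :=
  [set c | exists t : labeled_tree,
     [/\ codes_tree c t, borel_tree t &
       let E x y := coded_set B t (x, y) in
       [/\ equivalence_relation E, Gdelta (coded_set B t) & learnable E]]].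

(* Main.v *)
Require Import Defs.
From HB Require Import structures.
From mathcomp Require Import all_boot all_order all_algebra.
From mathcomp Require Import all_classical all_reals.
From mathcomp Require Import topology sequences cantor borel_hierarchy.

(** Call a set mixed along [F] if both the set and its complement are dense in
    the nonempty set [F]. A set mixed along no [F] is both [Fsigma] and
    [Gdelta], and an equivalence relation [E] on Cantor space is [Gdelta] and
    learnable exactly if it is mixed along no [F]: an [Fsigma] relation is
    learned by guessing the first candidate that is not yet refuted, while
    along a mixed [F] a learner of a [Gdelta] relation can be forced to change
    its mind infinitely often. By second countability [F] may be taken to be
    countable, so being mixed is an existential statement about a sequence of
    points and their membership bits, and on a well-founded code the bits are
    determined by local conditions on the nodes of the code. Hence the
    complement of the set of codes is [Sigma11].

    For hardness, the complement of a [Pi11] set [A] is the projection of a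
    closed set, which on a zero-dimensional space yields trees [T_x], depending
    continuously on [x], that are well-founded exactly if [x] is in [A]. Hang
    them into a code of the total relation; an ill-founded tree is no code. *)

Set Implicit Arguments.
Unset Strict Implicit.
Unset Printing Implicit Defensive.

Import Order.TTheory GRing.Theory Num.Theory.

Local Open Scope classical_set_scope.

(** * Ultrametric structure by levels of agreement *)

(* [agree n] plays the role of the relation of being at distance at most [2^-n]
   in a complete separable ultrametric. *)
Class levels (X : topologicalType) := Levels {
  agree : nat -> X -> X -> Prop;
  agree_refl : forall n x, agree n x x;
  agree_sym : forall n x y, agree n x y -> agree n y x;
  agree_trans : forall n y x z, agree n x y -> agree n y z -> agree n x z;
  agree_le : forall m n x y, m <= n -> agree n x y -> agree m x y;
  agree_nbhs : forall x U,
    nbhs x U <-> exists n, forall y, agree n x y -> U y;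
  agree_lim : forall u : nat -> X, (forall n, agree n (u n) (u n.+1)) ->
    exists l, forall n, agree n (u n) l;
  agree_dense : exists e : nat -> X, forall n x, exists k, agree n x (e k)
}.

Lemma closedN_agree (X : topologicalType) {LX : levels X} (C : set X) (x : X) :
  closed C -> ~ C x -> exists n, forall y, agree n x y -> ~ C y.
Proof.
move=> cC nCx; apply/agree_nbhs.
by apply: open_nbhs_nbhs; split=> //; exact: closed_openC.
Qed.

Lemma open_agreeP (X : topologicalType) {LX : levels X} (U : set X) :
  open U <-> forall x, U x -> exists n, forall y, agree n x y -> U y.
Proof.
rewrite openE; split=> oU x Ux; first exact/agree_nbhs/oU.
exact/agree_nbhs/oU.
Qed.

Lemma closed_agree (X : topologicalType) {LX : levels X} (n : nat) (x : X) :
  closed [set y | agree n x y].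
Proof.
rewrite -openC; apply/open_agreeP => y nxy; exists n => z yz xz.
by apply: nxy; apply: agree_trans xz _; exact: agree_sym.
Qed.

(** Equality serves as agreement at every level, so a coherent sequence is constant. *)
Lemma discrete_levels (X : topologicalType) (e : nat -> X) :
  (forall (x : X) (U : set X), nbhs x U <-> U x) ->
  (forall x, exists k, x = e k) -> levels X.
Proof.
move=> nX eX; exists (fun _ x y => x = y) => //.
- by move=> n y x z -> ->.
- by move=> x U; rewrite nX; split=> [Ux|[n]]; [exists 0 => y <-|exact].
- move=> u uE; exists (u 0) => n; elim: n => // n IHn.
  by rewrite -uE.
- by exists e => _ x; have [k ->] := eX x; exists k.
Defined.

#[global] Instance bool_levels : levels bool.
Proof.
apply: (@discrete_levels _ (fun k => k != 0)).
  by move=> x U; rewrite nbhs_principalE; split=> /principal_filterP.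
by case; [exists 1|exists 0].
Defined.

#[global] Instance nat_levels : levels nat.
Proof.
apply: (@discrete_levels _ id); last by move=> x; exists x.
by move=> x U; rewrite nbhs_principalE; split=> /principal_filterP.
Defined.

#[global] Instance prod_levels (X Y : topologicalType)
  (LX : levels X) (LY : levels Y) : levels (X * Y)%type.
Proof.
exists (fun n p q => agree n p.1 q.1 /\ agree n p.2 q.2).
- by move=> n x; split; exact: agree_refl.
- by move=> n x y [? ?]; split; exact: agree_sym.
- by move=> n y x z [? ?] [? ?]; split; apply: agree_trans; eassumption.
- by move=> m n x y mn [? ?]; split; exact: agree_le mn _.
- move=> [x y] U; split=> [[[V W] /= [/agree_nbhs[m mV] /agree_nbhs[n nW]] VWU]|].
    exists (maxn m n) => -[a b] /= [xa yb]; apply: VWU; split => /=.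
      by apply/mV/(agree_le _ xa); rewrite leq_maxl.
    by apply/nW/(agree_le _ yb); rewrite leq_maxr.
  move=> [n nU]; exists ([set a | agree n x a], [set b | agree n y b]).
    by split; apply/agree_nbhs; exists n.
  by move=> [a b] /= [? ?]; exact: nU.
- move=> u uE.
  have [l1 hl1] := agree_lim (fun n => (uE n).1).
  have [l2 hl2] := agree_lim (fun n => (uE n).2).
  by exists (l1, l2) => n; split=> /=.
- have [e he] := @agree_dense X _; have [f hf] := @agree_dense Y _.
  exists (fun k => let p := odflt (0, 0) (unpickle k) in (e p.1, f p.2)).
  move=> n [x y]; have [i xi] := he n x; have [j yj] := hf n y.
  by exists (pickle (i, j)); rewrite pickleK.
Defined.

(** Level [n] asks for agreement at level [n] in the first [n] coordinates only, so precision and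
    number of coordinates grow together; this gives the product topology. *)
#[global] Instance seq_levels (Y : topologicalType) (LY : levels Y) :
  levels (prod_topology (fun _ : nat => Y)).
Proof.
exists (fun n x y => forall i, i < n -> agree n (x i) (y i)).
- by move=> n x i _; exact: agree_refl.
- by move=> n x y xy i /xy; exact: agree_sym.
- by move=> n y x z xy yz i ni; apply: (agree_trans (xy i ni)) (yz i ni).
- move=> m n x y mn xy i im; apply: (agree_le mn); apply: xy.
  exact: leq_trans mn.
- move=> x U; split.
    pose F := filter_from [set: nat]
      (fun n => [set y : prod_topology (fun _ : nat => Y) |
         forall i, i < n -> @agree Y LY n (x i) (y i)]).
    have FF : Filter F.
      apply: filter_from_filter; first by exists 0.
      move=> m n _ _; exists (maxn m n) => // y /= xy.
      split=> i lti.
        by apply: (agree_le (leq_maxl m n)); apply: xy; rewrite leq_max lti.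
      apply: (agree_le (leq_maxr m n)); apply: xy.
      by rewrite leq_max lti orbT.
    have Fx : F --> x.
      apply/cvg_sup => i V /= [_ [[W oW <-] /= Wx WV]].
      have /agree_nbhs[n nW] : nbhs (x i) W by apply: open_nbhs_nbhs.
      exists (maxn n i.+1) => // y /= xy; apply: WV => /=; apply: nW.
      apply: (agree_le (leq_maxl n i.+1)); apply: xy.
      by rewrite leq_max ltnSn orbT.
    by move=> /Fx[n _ nU]; exists n => y xy; exact: nU.
  move=> [n nU].
  have : forall m, nbhs x [set y : prod_topology (fun _ : nat => Y) |
      forall i, i < m -> agree n (x i) (y i)].
    elim=> [|m IHm]; first exact: filterS filterT.
    have xm : nbhs x [set y : prod_topology (fun _ : nat => Y) |
        agree n (x m) (y m)].
      apply: (@proj_continuous _ (fun=> Y) m x); apply/agree_nbhs; by exists n.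
    apply: filterS (filterI IHm xm) => y [ym ymm] i.
    by rewrite ltnS leq_eqVlt => /orP[/eqP->|/ym].
  by move=> /(_ n); apply: filterS.
- move=> u uE.
  (* Coordinate [i] is controlled only from stage [i.+1] on; earlier stages are replaced by that
     one. *)
  have hl i : exists l, forall j, agree j (u (maxn j i.+1) i) l.
    apply: agree_lim => j; have [ij|] := boolP (i < j).
            have -> : maxn j i.+1 = j by exact/maxn_idPl.
      have -> : maxn j.+1 i.+1 = j.+1 by apply/maxn_idPl; exact: leqW.
      exact: uE.
    rewrite -leqNgt => ji.
    have -> : maxn j i.+1 = i.+1 by apply/maxn_idPr; exact: leqW.
    have -> : maxn j.+1 i.+1 = i.+1 by exact/maxn_idPr.
    exact: agree_refl.
  have [l hl'] := choice hl; exists l => n i ni.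
  by have := hl' i n; rewrite (maxn_idPl _).
- have [e he] := @agree_dense Y _.
  (* Sequences that are eventually [e 0], given by a finite list of indices, are dense. *)
  exists (fun k i => e (nth 0 (CodeSeq.decode k) i)) => n x.
  have [f hf] := choice (fun i => he n (x i)).
  exists (CodeSeq.code (mkseq f n)) => i ni.
  by rewrite CodeSeq.codeK nth_mkseq.
Defined.

#[global] Instance cantor_levels : levels cantor_space := seq_levels bool_levels.
#[global] Instance baire_levels : levels baire_space := seq_levels nat_levels.
#[global] Instance cantor_seq_levels : levels cantor_seq :=
  seq_levels cantor_levels.

(** * Continuity and convergence in terms of levels *)

Lemma continuous_agreeP (X Y : topologicalType) {LX : levels X}
    {LY : levels Y} (f : X -> Y) :
  continuous f <->
  forall x n, exists m, forall y, agree m x y -> agree n (f x) (f y).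
Proof.
split=> [cf x n|hf x U].
  by apply/agree_nbhs; apply: (cf x [set y | agree n (f x) y]);
    apply/agree_nbhs; exists n.
move=> /agree_nbhs[n nU]; have [m hm] := hf x n.
by apply/agree_nbhs; exists m => y /hm /nU.
Qed.

Lemma continuous_pair (X Y Z : topologicalType) (f : X -> Y) (g : X -> Z) :
  continuous f -> continuous g -> continuous (fun x => (f x, g x)).
Proof. by move=> cf cg x; apply: cvg_pair; [exact: cf|exact: cg]. Qed.

Lemma continuous_fst (X Y : topologicalType) : continuous (@fst X Y).
Proof. by move=> p; exact: cvg_fst. Qed.

Lemma continuous_snd (X Y : topologicalType) : continuous (@snd X Y).
Proof. by move=> p; exact: cvg_snd. Qed.

Lemma continuous_reindex (g : nat -> nat) :
  continuous (fun z : baire_space => (fun i => z (g i)) : baire_space).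
Proof.
apply/continuous_agreeP => z n; exists (\max_(i < n) g i).+1 => y zy i lin.
by apply: (zy (g i)); rewrite ltnS (leq_bigmax (Ordinal lin)).
Qed.

Lemma continuous_reindex_snd (X : topologicalType) (g : nat -> nat) :
  continuous (fun p : X * baire_space => (fun i => p.2 (g i)) : baire_space).
Proof.
move=> p; apply: (@continuous_comp _ _ _ snd
  (fun z : baire_space => (fun i => z (g i)) : baire_space)).
  exact: continuous_snd.
exact: continuous_reindex.
Qed.

Lemma closed_preimage (X Y : topologicalType) (f : X -> Y) (C : set Y) :
  continuous f -> closed C -> closed (f @^-1` C).
Proof. by move=> /continuous_closedP; exact. Qed.

Lemma continuous_natP (X : topologicalType) {LX : levels X} (f : X -> nat) :
  continuous f <-> forall x, exists n, forall y, agree n x y -> f y = f x.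
Proof.
split=> [cf x|hf x U].
  apply/agree_nbhs; apply: (cf x [set m | m = f x]).
  by rewrite nbhs_principalE; apply/principal_filterP.
rewrite nbhs_principalE => /principal_filterP Ufx.
have [n hn] := hf x; apply/agree_nbhs; exists n => y /hn.
by rewrite /preimage /= => ->.
Qed.

Lemma cvg_natP (u : nat -> nat) (L : nat) :
  u n @[n --> \oo] --> L <-> exists N, forall n, N <= n -> u n = L.
Proof.
split=> [uL|[N hN] U].
  have [|N _ hN] := uL [set m | m = L].
    by rewrite nbhs_principalE; apply/principal_filterP.
  by exists N => n Nn; exact: hN.
rewrite nbhs_principalE => /principal_filterP UL.
by exists N => // n /= /hN; rewrite /preimage /= => ->.
Qed.

(** * Mixed sets *)

Section Fsigma_levels.
Context (X : topologicalType) {LX : levels X}.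
Implicit Types (A F C : set X).

Lemma Fsigma_bigcup (F : nat -> set X) :
  (forall n, Fsigma (F n)) -> Fsigma (\bigcup_n F n).
Proof.
move=> hF.
have [G hG] : {G : nat -> nat -> set X &
    forall n, (forall m, closed (G n m)) /\ F n = \bigcup_m G n m}.
  by apply: (@choice _ _ (fun n G => (forall m, closed (G m)) /\
    F n = \bigcup_m G m)) => n; have [G ? ?] := hF n; exists G.
exists (fun k => let p := odflt (0, 0) (unpickle k) in G p.1 p.2).
  by move=> k; apply: (hG _).1.
apply/seteqP; split=> [x [n _]|x [k _ Gx]].
  rewrite (hG n).2 => -[m _ Gx]; exists (pickle (n, m)) => //=.
  by rewrite pickleK.
exists (odflt (0, 0) (unpickle k)).1 => //; rewrite (hG _).2.
by exists (odflt (0, 0) (unpickle k)).2.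
Qed.

Lemma Fsigma_setU A F : Fsigma A -> Fsigma F -> Fsigma (A `|` F).
Proof.
move=> hA hF; have -> : A `|` F = \bigcup_n (if n is 0 then A else F).
  apply/seteqP; split=> [x [Ax|Fx]|x [[|n] _]]; [by exists 0|by exists 1| |].
    by left.
  by right.
by apply: Fsigma_bigcup => -[|n].
Qed.

Lemma Fsigma_setI_closed A C : Fsigma A -> closed C -> Fsigma (C `&` A).
Proof.
move=> [F cF ->] cC; exists (fun n => C `&` F n).
  by move=> n; exact: closedI.
by rewrite setI_bigcupr.
Qed.

Definition mixed A F :=
  F !=set0 /\ forall x n, F x ->
    (exists y, [/\ F y, A y & agree n x y]) /\
    (exists y, [/\ F y, ~ A y & agree n x y]).

(* The complement of the largest open set in which both [A] and its complement
   are [Fsigma] is mixed unless it is empty. *)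
Lemma unmixed_Fsigma A :
  (forall F, ~ mixed A F) -> Fsigma A /\ Fsigma (~` A).
Proof.
move=> unmixed; have [e he] := @agree_dense X _.
pose b k : set X :=
  let p := odflt (0, 0) (unpickle k) in [set y | @agree X LX p.2 (e p.1) y].
have cb k : closed (b k) by exact: closed_agree.
(* [W] is a countable union of balls, so both properties pass from the good balls to [W]. *)
pose good k := Fsigma (b k `&` A) /\ Fsigma (b k `&` ~` A).
pose W := \bigcup_(k in good) b k.
have FsigmaW (D : set X) : (forall k, good k -> Fsigma (b k `&` D)) ->
    Fsigma (W `&` D).
  move=> hD.
  have -> : W `&` D = \bigcup_k (if `[< good k >] then b k `&` D else set0).
    apply/seteqP; split=> [x [[k gk bx] Dx]|x [k _]].
      by exists k => //; case: asboolP.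
    by case: asboolP => // gk [bx Dx]; split=> //; exists k.
  apply: Fsigma_bigcup => k; case: asboolP => [/hD //|_].
  exact/closed_Fsigma/closed0.
have WA : Fsigma (W `&` A) by apply: FsigmaW => k [].
have WnA : Fsigma (W `&` ~` A) by apply: FsigmaW => k [].
have cW : closed (~` W).
  apply: open_closedC; apply: bigcup_open => k _; apply/open_agreeP => x bx.
  by exists (odflt (0, 0) (unpickle k)).2 => y; exact: agree_trans.
(* If a ball around [x] met [D] only inside [W], its part outside [W] would be closed and disjoint
   from [D]; the ball would then be good and [x] would lie in [W]. This is applied to [A] and to its
   complement. *)
have dense_part (D : set X) : Fsigma (W `&` D) -> Fsigma (W `&` ~` D) ->
    (forall k, Fsigma (b k `&` D) -> Fsigma (b k `&` ~` D) -> good k) ->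
    forall x n, ~ W x -> exists y, [/\ ~ W y, D y & agree n x y].
  move=> WD WnD goodD x n nWx; apply: contrapT => noy.
  have [m xm] := he n x; pose k := pickle (m, n).
  have bP y : b k y <-> agree n (e m) y by rewrite /b /k pickleK.
  have bD y : b k y -> D y -> W y.
    move=> /bP by_ Dy; apply: contrapT => nWy; apply: noy; exists y.
    by split=> //; exact: agree_trans xm _.
  apply: nWx; exists k; last by apply/bP; exact: agree_sym.
  apply: goodD.
    have -> : b k `&` D = b k `&` (W `&` D).
      apply/seteqP; split=> [y [bky Dy]|y [? [? ?]] //].
      by split=> //; split=> //; exact: bD.
    exact: Fsigma_setI_closed.
  have -> : b k `&` ~` D = (b k `&` (W `&` ~` D)) `|` (b k `&` ~` W).
    apply/seteqP; split=> [y [bky nDy]|y [[? [? ?]] //|[bky nWy]]].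
      by have [Wy|nWy] := pselect (W y); [left|right].
    by split=> // /(bD _ bky).
  apply: Fsigma_setU; first exact: Fsigma_setI_closed.
  by apply: closed_Fsigma; exact: closedI.
have [[x nWx]|W_T] := pselect (exists x, ~ W x); last first.
  have eW D : W `&` D = D.
    apply/seteqP; split=> [x []//|x Dx]; split=> //.
    by apply: contrapT => nWx; apply: W_T; exists x.
  by rewrite !eW in WA WnA.
case: (unmixed (~` W)); split; first by exists x.
move=> y n nWy; split; first exact: dense_part.
have := @dense_part (~` A) WnA; rewrite setCK => /(_ WA); apply=> //.
Qed.

(** For each basic ball and each membership bit, one point of [F] realizing both is chosen, if there
    is any; countably many points result. *)
Lemma mixed_range A F : mixed A F ->
  exists q : nat -> X, mixed A (range q).
Proof.
move=> [[x0 Fx0] mF]; have [e he] := @agree_dense X _.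
(* The index lists the center, the level and the membership bit. *)
pose want (k : nat * nat * bool) z :=
  (A z <-> k.2) /\ @agree X LX k.1.2 (e k.1.1) z.
have [q hq] : {q & forall k, F (q k) /\
    ((exists2 y, F y & want k y) -> want k (q k))}.
  apply: (@choice _ _ (fun k z => F z /\
    ((exists2 y, F y & want k y) -> want k z))) => k.
  have [[y Fy ?]|ny] := pselect (exists2 y, F y & want k y); first by exists y.
  by exists x0.
pose q' k := q (odflt (0, 0, false) (unpickle k)).
exists q'; split; first by exists (q' 0); exists 0.
move=> _ n [i _ <-]; have Fi : F (q' i) by exact: (hq _).1.
have [m im] := he n (q' i).
have key (bb : bool) y : F y -> (A y <-> bb) -> agree n (q' i) y ->
    exists2 z, range q' z & (A z <-> bb) /\ agree n (q' i) z.
  move=> Fy Ay iy; exists (q (m, n, bb)).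
    by exists (pickle (m, n, bb)) => //; rewrite /q' pickleK.
  have [|Az mz] := (hq (m, n, bb)).2.
    by exists y => //; split=> //; apply: agree_trans (agree_sym im) _.
  by split=> //; exact: agree_trans im mz.
have [[y [Fy Ay iy]] [z [Fz Az iz]]] := mF _ n Fi; split.
  by have [|w qw [[_ Aw] iw]] := key true y Fy _ iy; [|exists w; split=> //; exact: Aw].
by have [|w qw [[Aw _] iw]] := key false z Fz _ iz; [|exists w; split=> // /Aw].
Qed.

(** A Baire category construction: the approximations stay in [P], and each step secures one
    requirement on a whole ball. The nested balls shrink to a point meeting all requirements; [P]
    constrains the approximations, not the limit. *)
Lemma fusion (P : set X) (Q : nat -> set X) (x0 : X) (n0 : nat) : P x0 ->
  (forall j n x, P x -> exists y,
     [/\ P y, agree n x y & exists m, forall z, agree m y z -> Q j z]) ->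
  exists2 z, agree n0 x0 z & forall j, Q j z.
Proof.
move=> Px0 step.
(* A state is a point with the level of the ball to stay in. Levels increase strictly, so the level
   at stage [j] is at least [j] and the points converge. *)
pose T (a : nat * (X * nat)) (b : X * nat) := P a.2.1 ->
  [/\ P b.1, @agree X LX a.2.2 a.2.1 b.1, a.2.2 < b.2 &
      forall z, @agree X LX b.2 b.1 z -> Q a.1 z].
have [f hf] : {f & forall a, T a (f a)}.
  apply: choice => -[j [x n]]; rewrite /T /=.
  have [Px|nPx] := pselect (P x); last by exists (x, n) => /nPx.
  have [y [Py xy [m hm]]] := step j n x Px.
  exists (y, maxn m n.+1) => _; split=> //=; first by rewrite leq_max ltnSn orbT.
  by move=> z yz; apply/hm/(agree_le _ yz); rewrite leq_maxl.
pose s := fix s j := if j is j'.+1 then f (j', s j') else (x0, n0).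
have Ps j : P (s j).1 by elim: j => //= j /(hf (j, s j))[].
have sS j := hf (j, s j) (Ps j).
have s_mono i j : (s j).2 <= (s (j + i)).2.
  elim: i => [|i IHi]; first by rewrite addn0.
  by rewrite addnS (leq_trans IHi) //; case: (sS (j + i)) => _ _ /ltnW.
have s_ge j : j <= (s j).2.
  by elim: j => // j IHj; case: (sS j) => _ _ /= + _; exact: leq_ltn_trans.
have chain i j : agree (s j).2 (s j).1 (s (j + i)).1.
  elim: i => [|i IHi]; first by rewrite addn0; exact: agree_refl.
  rewrite addnS; apply: agree_trans IHi _.
  by case: (sS (j + i)) => _ + _ _; apply: agree_le; exact: s_mono.
have [|l hl] := @agree_lim X _ (fun j => (s j).1).
  by move=> j; case: (sS j) => _ + _ _; apply: agree_le; exact: s_ge.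
have lim j : agree (s j).2 (s j).1 l.
  apply: (agree_trans (chain (s j).2 j)); apply: (agree_le _ (hl _)).
  exact: leq_addl.
exists l; first exact: (lim 0).
by move=> j; case: (sS j) => _ _ _; apply; exact: (lim j.+1).
Qed.

End Fsigma_levels.

(** * Learnability *)

Section Learnability.
Variable E : cantor_space -> cantor_space -> Prop.

Definition graph : set (cantor_space * cantor_space) := [set p | E p.1 p.2].

(** A candidate codes a pair [(i, n)] and claims that [(x, xs i)] lies in the closed set [F n]. At
    stage [s] it survives if [F n] meets the ball of level [s], and the first survivor gives the
    guess. False claims are refuted eventually; the least true one never is. *)
Lemma Fsigma_learnable : Fsigma graph -> learnable E.
Proof.
move=> [F cF EF].
pose dec m := odflt (0, 0) (unpickle m : option (nat * nat)).
pose cand s (w : cantor_seq * cantor_space) m :=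
  `[< exists2 q, F (dec m).2 q &
      @agree _ (prod_levels cantor_levels cantor_levels) s (w.2, w.1 (dec m).1) q >].
pose l s w := (dec (find (cand s w) (iota 0 s))).1.
exists l.
  move=> s; apply/continuous_natP => w.
  (* Stage [s] consults only the candidates below [s]; this level is at least [s] and exceeds every
     sequence index they mention. *)
  exists (s + (\max_(m < s) (dec m).1).+1) => w' [ww1 ww2]; rewrite /l.
  suff -> : find (cand s w') (iota 0 s) = find (cand s w) (iota 0 s) by [].
  apply: eq_in_find => m; rewrite mem_iota add0n => /= ms.
  have ag : @agree _ (prod_levels cantor_levels cantor_levels) s
      (w.2, w.1 (dec m).1) (w'.2, w'.1 (dec m).1).
    split; [apply: agree_le ww2|apply: agree_le (ww1 _ _)]; rewrite ?leq_addr //.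
    by rewrite ltn_addl // ltnS (leq_bigmax (Ordinal ms)).
  by apply: asbool_equiv_eq; split=> -[q Fq wq]; exists q => //;
    apply: agree_trans wq => //; exact: agree_sym.
move=> x xs [i Exi].
have : exists m, `[< F (dec m).2 (x, xs (dec m).1) >].
  have : graph (x, xs i) by [].
  rewrite EF => -[n _ Fn]; exists (pickle (i, n)); apply/asboolP.
  by rewrite /dec pickleK.
case/ex_minnP => m0 /asboolP Fm0 m0_min.
exists (dec m0).1; last first.
  by rewrite -[E _ _]/(graph (x, xs (dec m0).1)) EF; exists (dec m0).2.
(* [k m] is a level refuting the false candidate [m] below [m0]. *)
have [k hk] : {k : nat -> nat & forall m, m < m0 ->
    forall q, @agree _ (prod_levels cantor_levels cantor_levels)
      (k m) (x, xs (dec m).1) q -> ~ F (dec m).2 q}.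
  apply: (@choice _ _ (fun m k => m < m0 ->
    forall q, @agree _ (prod_levels cantor_levels cantor_levels)
      k (x, xs (dec m).1) q -> ~ F (dec m).2 q)) => m.
  have [mm0|] := boolP (m < m0); last by exists 0.
  have [|n hn] := @closedN_agree _ _ _ (x, xs (dec m).1) (cF (dec m).2).
    by move=> /asboolP /m0_min; rewrite leqNgt mm0.
  by exists n.
apply/cvg_natP; exists (m0.+1 + \max_(m < m0) k m) => s sN.
rewrite /l; set f := find _ _; suff -> : f = m0 by [].
have m0s : m0 < s by apply: leq_trans sN; exact: leq_addr.
have cm0 : cand s (xs, x) m0.
  by apply/asboolP; exists (x, xs (dec m0).1) => //; exact: agree_refl.
have hasc : has (cand s (xs, x)) (iota 0 s).
  by apply/hasP; exists m0; rewrite ?mem_iota.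
have fs : f < s by rewrite -[s in _ < s](size_iota 0) -has_find.
apply/eqP; rewrite eqn_leq; apply/andP; split; rewrite leqNgt; apply/negP.
  by move=> /(before_find 0); rewrite nth_iota // add0n cm0.
move=> fm0; have := nth_find 0 hasc; rewrite nth_iota // add0n.
move=> /asboolP[q Fq xq]; apply: (hk _ fm0 q _ Fq).
apply: agree_le xq; apply: leq_trans sN; apply: leq_trans (leq_addl _ _).
exact: (leq_bigmax (Ordinal fm0)).
Qed.

Hypothesis Erel : equivalence_relation E.
Hypothesis EGdelta : Gdelta graph.
Hypothesis Elearn : learnable E.

Local Notation agree2 :=
  (@agree _ (prod_levels cantor_levels cantor_levels)).

(* Against a learner, build [x], [y] and candidates [xs] with [xs 0 = y] and
   [xs i \in A] for [i > 0], deciding finitely much at a time: near a pair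
   outside [E], a fresh candidate equivalent to [x] forces a positive guess;
   near a pair in [E], candidates not equivalent to [x] force the guess 0. In
   the limit [E x y] holds, yet the guesses do not converge. *)
Lemma unlearnable_mixed (F : set (cantor_space * cantor_space))
    (A : set cantor_space) :
  mixed graph F ->
  (forall p, F p -> ~ E p.1 p.2 -> exists2 a, A a & E p.1 a) ->
  (forall p, F p -> E p.1 p.2 -> forall a n, A a ->
     exists b, [/\ A b, agree n a b & ~ E p.1 b]) ->
  False.
Proof.
move=> [[p00 Fp00] mF] hA hA'.
have [U oU EU] := EGdelta; have [l cl hl] := Elearn.
(* The approximations keep the pair inside [E]. Requirement [j] brings the pair into [U j], moves
   candidate 0 towards the second point, and asks for both a nonzero and a zero guess at stages from
   [j] on. *)
pose P (s : (cantor_space * cantor_space) * cantor_seq) :=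
  [/\ F s.1, E s.1.1 s.1.2, forall i, 0 < i -> A (s.2 i) & s.2 0 = s.1.2].
pose Q j (s : (cantor_space * cantor_space) * cantor_seq) :=
  [/\ U j s.1, @agree _ cantor_levels j (s.2 0) s.1.2,
      exists2 m, j <= m & l m (s.2, s.1.1) <> 0 &
      exists2 m, j <= m & l m (s.2, s.1.1) = 0].
(* When some candidate is equivalent to [x], a late enough guess is correct, and by continuity it is
   fixed on a neighborhood. *)
have guess (x : cantor_space) (xs : cantor_seq) j :
    (exists i, E x (xs i)) -> exists m L, [/\ j <= m, E x (xs L) &
      exists n, forall xs' x', agree n x x' -> agree n xs xs' ->
        l m (xs', x') = L].
  move=> /hl[L /cvg_natP[N lN] ExL].
  exists (maxn j N), L; split=> //; first exact: leq_maxl.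
  have [n hn] := (continuous_natP _).1 (cl (maxn j N)) (xs, x).
  exists n => xs' x' xx' xsxs'.
  by rewrite -(lN (maxn j N)) ?leq_maxr //; apply: hn.
have [Erefl Esym Etrans] := Erel.
have [[p0 [Fp0 Ep0 _]] [p1 [Fp1 nEp1 _]]] := mF _ 0 Fp00.
have [a0 Aa0 _] := hA _ Fp1 nEp1.
have [] := @fusion _ _ P Q
  (p0, fun i => if i is 0 then p0.2 else a0) 0.
- by split=> // -[].
- move=> j n [p xs] [/= Fp Ep Axs xs0].
  have [_ [p' [Fp' nEp' [pp'1 pp'2]]]] := mF _ n Fp.
  have [a Aa Ea] := hA _ Fp' nEp'.
  (* The fresh candidate sits at [n.+1]: positive, and beyond the coordinates compared at level
     [n]. *)
  pose xs' : cantor_seq :=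
    fun i => if i is 0 then p'.2 else if i == n.+1 then a else xs i.
  have Axs' i : 0 < i -> A (xs' i).
    by case: i => // i _; rewrite /xs'; case: eqP => // _; exact: Axs.
  have xsxs' : agree n xs xs'.
    move=> [|i] lein; rewrite /xs'; first by rewrite xs0.
    have -> : (i.+1 == n.+1) = false.
      by apply/negbTE; rewrite neq_ltn ltnW.
    exact: agree_refl.
  have [|m [L [jm EL [n1 hn1]]]] := guess p'.1 xs' j.
    by exists n.+1; rewrite /xs' eqxx.
  have L0 : L <> 0 by move=> L0; apply: nEp'; rewrite L0 in EL.
  (* Agreement at this level preserves the nonzero guess just forced. *)
  pose n2 := maxn n (maxn n1 j).
  have [[p'' [Fp'' Ep'' [pp''1 pp''2]]] _] := mF _ n2 Fp'.
  (* All positive candidates are moved slightly out of the class of [p''.1]; only candidate 0 is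
     then a correct answer. *)
  have [b hb] : {b : cantor_seq & forall i, 0 < i ->
      [/\ A (b i), agree n2 (xs' i) (b i) & ~ E p''.1 (b i)]}.
    apply: (@choice _ _ (fun i bi => 0 < i ->
      [/\ A bi, @agree _ cantor_levels n2 (xs' i) bi & ~ E p''.1 bi])) => i.
    have [i0|] := boolP (0 < i); last by exists point.
    by have [c hc] := hA' _ Fp'' Ep'' (xs' i) n2 (Axs' i i0); exists c.
  pose xs'' : cantor_seq := fun i => if i is 0 then p''.2 else b i.
  have xs'xs'' : agree n2 xs' xs''.
    by move=> [|i] _ //; have [] := hb i.+1.
  have [|m' [L' [jm' EL' [n3 hn3]]]] := guess p''.1 xs'' j; first by exists 0.
  have L'0 : L' = 0.
    by case: L' EL' {hn3} => // i; have [//|_ _] := hb i.+1.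
  have [n4 hn4] : exists n, forall q, agree2 n p'' q -> U j q.
    apply: (open_agreeP _).1; first exact: oU.
    by have : graph p'' by []; rewrite EU; apply.
  exists (p'', xs''); split=> /=.
  + by split=> //= -[] // i _; have [] := hb i.+1.
  + have nn2 : n <= n2 by exact: leq_maxl.
    split; last exact: agree_trans xsxs' (agree_le nn2 xs'xs'').
    by split; [apply: agree_trans pp'1 (agree_le nn2 pp''1)|
               apply: agree_trans pp'2 (agree_le nn2 pp''2)].
  pose n5 := maxn n2 (maxn n3 n4).
  have n1n2 : n1 <= n2 by rewrite /n2 leq_max leq_max leqnn !orbT.
  have jn2 : j <= n2 by rewrite /n2 leq_max leq_max leqnn !orbT.
  have n2n5 : n2 <= n5 by exact: leq_maxl.
  have n3n5 : n3 <= n5 by rewrite /n5 leq_max leq_max leqnn !orbT.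
  have n4n5 : n4 <= n5 by rewrite /n5 leq_max leq_max leqnn !orbT.
  exists n5.+1 => -[q ys] [[q1 q2] qys].
  have {}q1 : agree n5.+1 p''.1 q.1 by [].
  have {}q2 : agree n5.+1 p''.2 q.2 by [].
  have ys0 : agree n5.+1 p''.2 (ys 0) by exact: (qys 0 isT).
  have {}qys : agree n5.+1 xs'' ys by [].
  split.
  + by apply: hn4; split; [apply: agree_le q1|apply: agree_le q2]; exact: leqW.
  + have : agree n5.+1 (ys 0) q.2 by exact: agree_trans (agree_sym ys0) q2.
    by apply: agree_le; rewrite leqW // (leq_trans jn2).
  + exists m => //; rewrite (hn1 ys q.1) //.
      apply: agree_trans (agree_le n1n2 pp''1) _.
      by apply: agree_le q1; rewrite leqW // (leq_trans n1n2).
    apply: agree_trans (agree_le n1n2 xs'xs'') _.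
    by apply: agree_le qys; rewrite leqW // (leq_trans n1n2).
  exists m' => //; rewrite (hn3 ys q.1) //; first by apply: agree_le q1; exact: leqW.
  by apply: agree_le qys; exact: leqW.
move=> [[x y] xs] _ hQ.
have Exy : E x y.
  rewrite -[E x y]/(graph (x, y)) EU => j _.
  by case: (hQ j).
have xs0 : xs 0 = y.
  by apply/funext => i; have [_ /= + _ _] := hQ i.+1; apply.
have [|L /cvg_natP[N lN] _] := hl x xs; first by exists 0; rewrite xs0.
have [_ _ [m Nm lm] [m' Nm' lm']] := hQ N.
by apply: lm => /=; rewrite lN // -(lN m').
Qed.

(** Otherwise the class is mixed along some [F], and the learner is defeated on the pairs in
    [{x} * F] with candidates from [F]. *)
Lemma class_Fsigma x : Fsigma [set y | E x y].
Proof.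
have [Erefl Esym Etrans] := Erel.
apply: (proj1 (@unmixed_Fsigma _ _ _ _)) => F [[z Fz] mF].
apply: (@unlearnable_mixed [set p | p.1 = x /\ F p.2] F).
- split; first by exists (x, z).
  move=> [_ y] n [/= -> Fy]; have [[u [Fu Eu yu]] [v [Fv nEv yv]]] := mF y n Fy.
  split; [exists (x, u)|exists (x, v)]; split=> //;
    by split=> //=; exact: agree_refl.
- move=> [_ y] [/= -> Fy] _; have [[u [Fu Eu yu]] _] := mF y 0 Fy.
  by exists u.
- move=> [_ y] [/= -> Fy] _ a n Fa; have [_ [u [Fu nEu yu]]] := mF a n Fa.
  by exists u.
Qed.

Lemma learnable_unmixed (F0 : set (cantor_space * cantor_space)) :
  ~ mixed graph F0.
Proof.
move=> mF0; have [Erefl Esym Etrans] := Erel.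
(* The closure of [F0]: still mixed, and limits of points of [F0] stay inside. *)
pose F : set (cantor_space * cantor_space) :=
  [set p | forall n, exists2 q, F0 q & agree2 n p q].
have F0F q : F0 q -> F q by move=> F0q n; exists q => //; exact: agree_refl.
have mF : mixed graph F.
  case: mF0 => [[z F0z] mF0]; split; first by exists z; exact: F0F.
  move=> p n Fp; have [q F0q pq] := Fp n.
  have [[u [F0u Eu qu]] [v [F0v Ev qv]]] := mF0 q n F0q.
  split; [exists u|exists v]; split=> //; try exact: F0F;
    exact: agree_trans pq _.
have [e he] := @agree_dense cantor_space _.
(* A class with nonempty interior contains some [e m], so there are only countably many. Outside
   them, every candidate can be moved slightly out of the class, and all of Cantor space can serve
   as the set of candidates. *)
pose fat x := exists m n, forall y, @agree _ cantor_levels n (e m) y -> E x y.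
have [K hK] : {K : cantor_space -> nat -> set cantor_space & forall x,
    (forall n, closed (K x n)) /\ [set y | E x y] = \bigcup_n K x n}.
  by apply: (@choice _ _ (fun x K => (forall n, closed (K n)) /\
    [set y | E x y] = \bigcup_n K n)) => x;
    have [K ? ?] := class_Fsigma x; exists K.
have [U oU EU] := EGdelta.
apply: (@unlearnable_mixed
  [set p | F p /\ (E p.1 p.2 -> ~ fat p.1)] setT).
- split.
    have [[z Fz] mF'] := mF; have [_ [y [Fy nEy _]]] := mF' z 0 Fz.
    by exists y.
  move=> p n [Fp _]; have [_ mF'] := mF; split; last first.
    by have [_ [y [Fy nEy py]]] := mF' p n Fp; exists y; split.
  apply: contrapT => noy.
  (* The squares of the classes of all [e m], which include every fat class, are covered by the
     closed sets [N j]. Fusion yields a pair of [E] in [F] near [p] that avoids them all. *)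
  pose dec j := odflt (0, 0, 0) (unpickle j : option (nat * nat * nat)).
  pose N j : set (cantor_space * cantor_space) :=
    K (e (dec j).1.1) (dec j).1.2 `*` K (e (dec j).1.1) (dec j).2.
  have cN j : closed (N j).
    apply: closedI.
      exact: closed_preimage (@continuous_fst _ _) ((hK _).1 _).
    exact: closed_preimage (@continuous_snd _ _) ((hK _).1 _).
  have NE j q : N j q -> E q.1 q.2.
    have KE m i y : K (e m) i y -> E (e m) y.
      by move=> Ky; rewrite -[E _ _]/([set y | E (e m) y] y) (hK _).2; exists i.
    by move=> [/KE/Esym ? /KE ?]; exact: Etrans (e (dec j).1.1) _ _ _.
  have [] := @fusion _ _ [set q | F q /\ agree2 n p q]
    (fun j q => [/\ U j q, ~ N j q, exists2 q', F0 q' & agree2 j q q' &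
       agree2 n p q]) p n.
  + by split=> //; exact: agree_refl.
  + move=> j k q [Fq pq].
    (* A nearby pair outside [E] has a ball missing [N j], as [N j] is closed and contained in [E];
       inside this ball the construction returns to [E]. *)
    have [_ [q1 [Fq1 nEq1 qq1]]] := mF' q (maxn k n) Fq.
    have [k1 hk1] := closedN_agree (cN j) (fun Nq1 => nEq1 (NE _ _ Nq1)).
    have [[q2 [Fq2 Eq2 q12]] _] := mF' q1 (maxn (maxn k n) k1) Fq1.
    have qq2 : agree2 (maxn k n) q q2.
      by apply: agree_trans qq1 (agree_le _ q12); exact: leq_maxl.
    have pq2 : agree2 n p q2.
      by apply: agree_trans pq (agree_le _ qq2); exact: leq_maxr.
    exists q2; split=> //; first by apply: agree_le qq2; exact: leq_maxl.
    have [k2 hk2] : exists k, forall z, agree2 k q2 z -> U j z.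
      apply: (open_agreeP _).1; first exact: oU.
      by have : graph q2 by []; rewrite EU; apply.
    have [q' F0q' q2q'] := Fq2 j.
    exists (maxn (maxn k1 k2) (maxn j n)) => z q2z; split.
    * by apply: hk2; apply: agree_le q2z; rewrite !leq_max leqnn !orbT.
    * apply: hk1; apply: agree_trans (agree_le _ q12) (agree_le _ q2z).
        exact: leq_maxr.
      by rewrite !leq_max leqnn.
    * exists q' => //; apply: agree_trans (agree_sym _) q2q'.
      by apply: agree_le q2z; rewrite !leq_max leqnn !orbT.
    * apply: agree_trans pq2 (agree_le _ q2z).
      by rewrite !leq_max leqnn !orbT.
  move=> z _ hz; apply: noy; exists z.
  have Ez : E z.1 z.2.
    by rewrite -[E _ _]/(graph z) EU => j _; case: (hz j).
  split=> //; last by case: (hz 0).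
  split=> [j|_ [m [k hm]]]; first by case: (hz j).
  have /Esym Em : E z.1 (e m) by apply: hm; exact: agree_refl.
  have Em2 : E (e m) z.2 by exact: Etrans Em Ez.
  have : [set y | E (e m) y] z.1 by [].
  rewrite (hK _).2 => -[i1 _ K1].
  have : [set y | E (e m) y] z.2 by [].
  rewrite (hK _).2 => -[i2 _ K2].
  have [_ + _ _] := hz (pickle (m, i1, i2)); apply.
  by rewrite /N /dec pickleK.
- by move=> p _ _; exists p.1.
- move=> p [Fp nfat] Ep a n _; apply: contrapT => nob.
  have [m am] := he n a; apply: (nfat Ep); exists m, n => y my.
  apply: contrapT => nEy; apply: nob; exists y; split=> //.
  exact: agree_trans am my.
Qed.

End Learnability.

Lemma Gdelta_learnableP (E : cantor_space -> cantor_space -> Prop) :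
  equivalence_relation E ->
  (Gdelta (graph E) /\ learnable E) <-> forall F, ~ mixed (graph E) F.
Proof.
move=> Erel; split=> [[EG El] F|unmixed]; first exact: learnable_unmixed.
have [EF [G cG GE]] := unmixed_Fsigma unmixed.
split; last exact: Fsigma_learnable.
exists (fun i => ~` G i); first by move=> i; exact: closed_openC.
by rewrite -setC_bigcup -GE setCK.
Qed.

(** * Analytic sets *)

Section Sigma11_theory.
Context (X : topologicalType).
Implicit Type A : set X.

Lemma Sigma11_closed A : closed A -> Sigma11 A.
Proof.
move=> cA; exists (fst @^-1` A).
  exact: closed_preimage (@continuous_fst _ _) cA.
apply/seteqP; split=> [x Ax|_ [[x z] /= Ax <-] //].
by exists (x, point).
Qed.

(** By pairing indices, a single witness carries a witness for each [A n]. *)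
Lemma Sigma11_bigcap (A : nat -> set X) :
  (forall n, Sigma11 (A n)) -> Sigma11 (\bigcap_n A n).
Proof.
move=> hA.
have [C hC] : {C : nat -> set (X * baire_space) &
    forall n, closed (C n) /\ A n = fst @` C n}.
  by apply: (@choice _ _ (fun n C => closed C /\ A n = fst @` C)) => n;
    have [C ? ?] := hA n; exists C.
pose g (n : nat) (p : X * baire_space) : X * baire_space :=
  (p.1, fun i => p.2 (pickle (n, i))).
exists (\bigcap_n (g n @^-1` C n)).
  apply: closed_bigI => n _; apply: closed_preimage (hC n).1.
  apply: continuous_pair; first exact: continuous_fst.
  exact: (@continuous_reindex_snd X (fun i => pickle (n, i))).
apply/seteqP; split=> [x Ax|_ [[x z] /= Cxz <-] n _]; last first.
  by rewrite (hC n).2; exists (g n (x, z)) => //; exact: Cxz.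
have [z hz] : {z : nat -> baire_space & forall n, C n (x, z n)}.
  apply: (@choice _ _ (fun n z => C n (x, z))) => n.
  have := Ax n I; rewrite (hC n).2 => -[[y z] Cyz /= yx].
  by exists z; rewrite -yx.
exists (x, fun k => let p := odflt (0, 0) (unpickle k) in z p.1 p.2) => // n _.
rewrite /g /preimage /=.
have -> : (fun i => (let p := odflt (0, 0) (unpickle (pickle (n, i))) in
    z p.1 p.2)) = z n by apply/funext => i; rewrite pickleK.
exact: hz.
Qed.

(** The first entry of the witness selects [n]; the remaining entries witness membership in
    [A n]. *)
Lemma Sigma11_bigcup (A : nat -> set X) :
  (forall n, Sigma11 (A n)) -> Sigma11 (\bigcup_n A n).
Proof.
move=> hA.
have [C hC] : {C : nat -> set (X * baire_space) &
    forall n, closed (C n) /\ A n = fst @` C n}.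
  by apply: (@choice _ _ (fun n C => closed C /\ A n = fst @` C)) => n;
    have [C ? ?] := hA n; exists C.
pose g (p : X * baire_space) : X * baire_space := (p.1, fun i => p.2 i.+1).
have cg : continuous g.
  apply: continuous_pair; first exact: continuous_fst.
  exact: (@continuous_reindex_snd X S).
exists (\bigcap_n ([set p : X * baire_space | p.2 0 <> n] `|` g @^-1` C n)).
  apply: closed_bigI => n _; apply: closedU; last first.
    exact: closed_preimage cg (hC n).1.
  apply: (@closed_preimage _ _ snd [set z : baire_space | z 0 <> n]).
    exact: continuous_snd.
  rewrite -openC; apply/open_agreeP => z z0; exists 1 => y zy /=.
  by rewrite -(zy 0 isT).
apply/seteqP; split=> [x [n _]|_ [[x z] /= Cxz <-]].
  rewrite (hC n).2 => -[[y z] Cyz /= yx].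
  exists (x, fun i => if i is j.+1 then z j else n) => // m _ /=.
  have [<-|] := eqVneq n m; last by move=> /eqP nm; left.
  by right; rewrite /g /preimage /= -yx.
exists (z 0) => //; rewrite (hC _).2; exists (g (x, z)) => //.
by case: (Cxz (z 0) I).
Qed.

End Sigma11_theory.

(** Two witnesses are merged into one, at the even and the odd entries. *)
Lemma Sigma11_proj (X : topologicalType) (A : set (X * baire_space)) :
  Sigma11 A -> Sigma11 [set x | exists z, A (x, z)].
Proof.
move=> [C cC ->].
pose g (p : X * baire_space) : (X * baire_space) * baire_space :=
  (p.1, fun i => p.2 i.*2, fun i => p.2 i.*2.+1).
exists (g @^-1` C).
  apply: closed_preimage cC; apply: continuous_pair; first apply: continuous_pair.
  - exact: continuous_fst.
  - exact: (@continuous_reindex_snd X double).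
  - exact: (@continuous_reindex_snd X (fun i => i.*2.+1)).
apply/seteqP; split=> [x [z [[[y z1] z2] Cp /= [yx z1z]]]|_ [[x z] Cp <-]].
  exists (x, fun i => if odd i then z2 i./2 else z i./2) => //.
  rewrite /g /preimage /=.
  have -> : (fun i => if odd i.*2 then z2 (i.*2)./2 else z (i.*2)./2) = z.
    by apply/funext => i; rewrite odd_double doubleK.
  have -> : (fun i => if ~~ odd i.*2 then z2 (uphalf i.*2) else
      z (uphalf i.*2)) = z2.
    by apply/funext => i; rewrite odd_double uphalf_double.
  by rewrite -yx -z1z.
by exists (fun i => z i.*2), (g (x, z)).
Qed.

(** * Bi-analytic predicates *)

Section Delta11_theory.
Context (X : topologicalType).
Implicit Types P Q : X -> Prop.

(** This plays the role of Borel: closure under negation and countable quantifiers lets complexity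
    be read off from the form of a predicate. *)
Definition Delta11 P := Sigma11 [set x | P x] /\ Sigma11 [set x | ~ P x].

Lemma Delta11_not P : Delta11 P -> Delta11 (fun x => ~ P x).
Proof.
move=> [SP SnP]; split=> //.
by rewrite (_ : [set x | ~ ~ P x] = [set x | P x]) //;
  apply/seteqP; split=> x /= ?; [exact: contrapT|].
Qed.

Lemma Delta11_forall_nat (P : nat -> X -> Prop) :
  (forall n, Delta11 (P n)) -> Delta11 (fun x => forall n, P n x).
Proof.
move=> hP; split.
  have -> : [set x | forall n, P n x] = \bigcap_n [set x | P n x].
    by apply/seteqP; split=> [x h n _|x h n]; [exact: h|exact: (h n I)].
  by apply: Sigma11_bigcap => n; case: (hP n).
have -> : [set x | ~ forall n, P n x] = \bigcup_n [set x | ~ P n x].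
  apply/seteqP; split=> [x /= /existsNP[n nP]|x [n _ nP] /=]; first by exists n.
  by apply/existsNP; exists n.
by apply: Sigma11_bigcup => n; case: (hP n).
Qed.

Lemma Delta11_cst (Q : Prop) : Delta11 (fun=> Q).
Proof.
have SQ (T : Prop) : Sigma11 [set _ : X | T].
  have [t|nt] := pselect T.
    rewrite (_ : [set _ | T] = setT); first exact/Sigma11_closed/closedT.
    by apply/seteqP; split.
  rewrite (_ : [set _ | T] = set0); first exact/Sigma11_closed/closed0.
  by apply/seteqP; split.
by split.
Qed.

Lemma Delta11_forall (I : countType) (P : I -> X -> Prop) :
  (forall i, Delta11 (P i)) -> Delta11 (fun x => forall i, P i x).
Proof.
move=> hP.
have -> : (fun x => forall i, P i x) =
    (fun x => forall n, (if unpickle n is Some i then P i else fun=> True) x).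
  apply/funext => x; apply/propext; split=> [h n|h i].
    by case: unpickle.
  by have := h (pickle i); rewrite pickleK.
by apply: Delta11_forall_nat => n; case: unpickle => [i|]; [exact: hP|exact: Delta11_cst].
Qed.

Lemma Delta11_exists (I : countType) (P : I -> X -> Prop) :
  (forall i, Delta11 (P i)) -> Delta11 (fun x => exists i, P i x).
Proof.
move=> hP.
have -> : (fun x => exists i, P i x) = (fun x => ~ forall i, ~ P i x).
  apply/funext => x; apply/propext; split=> [[i Pi] /(_ i) //|].
  by move=> /existsNP[i /contrapT Pi]; exists i.
by apply/Delta11_not/Delta11_forall => i; exact: Delta11_not.
Qed.

Lemma Delta11_and P Q : Delta11 P -> Delta11 Q -> Delta11 (fun x => P x /\ Q x).
Proof.
move=> hP hQ.
have -> : (fun x => P x /\ Q x) = (fun x => forall b : bool, (if b then P else Q) x).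
  by apply/funext => x; apply/propext; split=> [[? ?] []|h] //;
    split; [exact: (h true)|exact: (h false)].
by apply: Delta11_forall => -[].
Qed.

Lemma Delta11_or P Q : Delta11 P -> Delta11 Q -> Delta11 (fun x => P x \/ Q x).
Proof.
move=> hP hQ.
have -> : (fun x => P x \/ Q x) = (fun x => exists b : bool, (if b then P else Q) x).
  by apply/funext => x; apply/propext; split=> [[? |?]|[[] ?]];
    [exists true|exists false|left|right].
by apply: Delta11_exists => -[].
Qed.

Lemma Delta11_imp P Q : Delta11 P -> Delta11 Q -> Delta11 (fun x => P x -> Q x).
Proof.
move=> hP hQ.
have -> : (fun x => P x -> Q x) = (fun x => ~ P x \/ Q x).
  apply/funext => x; apply/propext; split=> [PQ|[nP /nP|]] //.
  by have [/PQ|] := pselect (P x); [right|left].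
by apply: Delta11_or => //; exact: Delta11_not.
Qed.

Lemma Delta11_iff P Q : Delta11 P -> Delta11 Q -> Delta11 (fun x => P x <-> Q x).
Proof. by move=> hP hQ; apply: Delta11_and; exact: Delta11_imp. Qed.

Lemma Delta11_clopen P : clopen [set x | P x] -> Delta11 P.
Proof.
by move=> [oP cP]; split; apply: Sigma11_closed => //; exact: open_closedC.
Qed.

End Delta11_theory.

(** * The upper bound *)

Definition label_of_index (n : nat) : label :=
  match n with 0 => Cup | 1 => Cap | k.+2 => Basic k end.

Lemma label_indexK : cancel label_index label_of_index.
Proof. by case. Qed.

HB.instance Definition _ := Countable.copy label (can_type label_indexK).

(** Failure of [Q] at a node passes to a child, so failure at the root would produce an infinite
    branch. *)
Lemma tree_root_ind (t : labeled_tree) (Q : seq nat -> Prop) :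
  node t [::] -> well_founded_tree t ->
  (forall s, node t s -> (forall n, node t (rcons s n) -> Q (rcons s n)) ->
     Q s) -> Q [::].
Proof.
move=> root wf step; apply: contrapT => nQ.
have [g hg] : {g : seq nat -> nat & forall s, node t s /\ ~ Q s ->
    node t (rcons s (g s)) /\ ~ Q (rcons s (g s))}.
  apply: (@choice _ _ (fun s n => node t s /\ ~ Q s ->
    node t (rcons s n) /\ ~ Q (rcons s n))) => s.
  have [[ns nQs]|] := pselect (node t s /\ ~ Q s); last by exists 0.
  have [n hn] : exists n, node t (rcons s n) /\ ~ Q (rcons s n).
    apply: contrapT => noex; apply: nQs; apply: step => // n nn.
    by apply: contrapT => nQn; apply: noex; exists n.
  by exists n.
pose b := fix b n := if n is m.+1 then rcons (b m) (g (b m)) else [::].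
have bE n : mkseq (fun i => g (b i)) n = b n.
  by elim: n => // n IHn; rewrite mkseqS IHn.
have hb n : node t (b n) /\ ~ Q (b n) by elim: n => //= n; exact: hg.
by apply: wf; exists (fun i => g (b i)) => n; rewrite bE; case: (hb n).
Qed.

(** * Codes, evaluations and their counterexamples *)

Section Codes.
Variable B : nat -> set (cantor_space * cantor_space).
Implicit Types (c : cantor_space) (p : cantor_space * cantor_space).

Definition code_node c s := exists a, c (entry_index s a) = true.

(** The conditions on a code apart from well-foundedness, with countable quantifiers only. *)
Definition tree_code c : Prop :=
  [/\ forall s a b, c (entry_index s a) = true -> c (entry_index s b) = true ->
        a = b,
      code_node c [::],
      forall s n, code_node c (rcons s n) -> code_node c s &
      forall s a, c (entry_index s a) = true ->
        (exists n, code_node c (rcons s n)) <-> a = Cup \/ a = Cap].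

Lemma code_nodeP c t s : codes_tree c t -> code_node c s <-> node t s.
Proof.
move=> ct; rewrite /node; split=> [[a /ct -> //]|].
by case E: (t s) => [a|] // _; exists a; apply/ct.
Qed.

Lemma tree_codeP c :
  tree_code c <-> exists t, [/\ codes_tree c t, is_tree t & well_labeled t].
Proof.
split=> [[cfun croot cpre clab]|[t [ct [troot tpre] tlab]]]; last first.
  have nodeE s := @code_nodeP c t s ct; split.
  - by move=> s a b /ct ta /ct; rewrite ta => -[].
  - exact/nodeE.
  - by move=> s n /nodeE/tpre/nodeE.
  - move=> s a /ct/tlab <-; split=> -[n /nodeE ?]; exists n => //.
have [t ct] : {t : labeled_tree & codes_tree c t}.
  apply: (@choice _ _ (fun s o =>
    forall a, c (entry_index s a) = true <-> o = Some a)) => s.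
  have [[a ca]|no] := pselect (code_node c s).
    by exists (Some a) => b; split=> [/(cfun _ _ _ ca) ->|[<-]].
  by exists None => a; split=> // ca; case: no; exists a.
have nodeE s := @code_nodeP c t s ct.
exists t; split=> //.
  by split=> [|s n /nodeE/cpre/nodeE //]; exact/nodeE.
move=> s a /ct/clab <-; split=> -[n /nodeE ?]; by exists n.
Qed.

(** Local conditions that replace the inductive [node_set]: they quantify over numbers, lists and
    labels only, and have a unique solution on the nodes of a well-founded tree. *)
Definition evaluation c p (v : seq nat -> Prop) : Prop :=
  forall s a, c (entry_index s a) = true ->
    (v s <-> match a with
             | Cup => exists n, code_node c (rcons s n) /\ v (rcons s n)
             | Cap => forall n, code_node c (rcons s n) -> v (rcons s n)
             | Basic k => B k p
             end).

Lemma evaluation_node_set c t p :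
  codes_tree c t -> evaluation c p (fun s => node_set B t s p).
Proof.
move=> ct; have nodeE s := @code_nodeP c t s ct.
move=> s a /ct ta; split.
  move=> h; inversion h as [s' k q tk Bk e1 e2|s' n q tk nn hn e1 e2|
    s' q tk hn e1 e2]; move: ta; rewrite tk => -[<-] //.
    by exists n; split=> //; exact/nodeE.
  by move=> n /nodeE; exact: hn.
case: a ta => [|| k] ta.
- by move=> [n [/nodeE nn hn]]; apply: node_set_cup hn.
- by move=> h; apply: node_set_cap => // n /nodeE; exact: h.
- exact: node_set_basic.
Qed.

Lemma evaluation_root c t p v :
  codes_tree c t -> borel_tree t -> evaluation c p v ->
  v [::] <-> coded_set B t p.
Proof.
move=> ct [[troot tpre] tlab twf] hv.
have nodeE s := @code_nodeP c t s ct.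
have hn := evaluation_node_set p ct.
apply: (@tree_root_ind t (fun s => v s <-> node_set B t s p)) => //.
move=> s ns IH; have [a ca] : code_node c s by exact/nodeE.
rewrite (hv s a ca) (hn s a ca); case: a {ca} => //.
  split=> -[n [nn h]]; exists n; split=> //; move: nn => /nodeE/IH[? ?]; auto.
by split=> h n nn; have := h n nn; have /nodeE/IH[? ?] := nn; auto.
Qed.

(* The first three cases refute an equivalence relation, the last one says that
   a set with membership bits [e] is mixed along the range of [p]. *)
Definition bad_points (p : nat -> cantor_space * cantor_space)
    (e : nat -> Prop) : Prop :=
  [\/ (forall i, (p 0).1 i = (p 0).2 i) /\ ~ e 0,
      (forall i, (p 0).1 i = (p 1).2 i /\ (p 0).2 i = (p 1).1 i) /\
        e 0 /\ ~ e 1,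
      (forall i, [/\ (p 0).1 i = (p 2).1 i, (p 0).2 i = (p 1).1 i &
         (p 1).2 i = (p 2).2 i]) /\ e 0 /\ e 1 /\ ~ e 2 |
      forall i n,
        (exists k, e k /\ forall j, j < n ->
           (p i).1 j = (p k).1 j /\ (p i).2 j = (p k).2 j) /\
        (exists k, ~ e k /\ forall j, j < n ->
           (p i).1 j = (p k).1 j /\ (p i).2 j = (p k).2 j)].

(** At most three pairs witness a failure of an equivalence axiom, and by [mixed_range] a sequence
    of pairs witnesses mixedness. *)
Lemma bad_pointsP (A : set (cantor_space * cantor_space)) :
  (equivalence_relation (fun x y => A (x, y)) /\ forall F, ~ mixed A F) <->
  forall p : nat -> _, ~ bad_points p (fun j => A (p j)).
Proof.
have agreeE n (p q : cantor_space * cantor_space) : agree n p q <->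
    forall j, j < n -> p.1 j = q.1 j /\ p.2 j = q.2 j.
  split=> [[h1 h2] j jn|h]; first by split; [exact: h1|exact: h2].
  by split=> j /h[].
have pairE (p : cantor_space * cantor_space) (x y : cantor_space) :
    (forall i, p.1 i = x i) -> (forall i, p.2 i = y i) -> p = (x, y).
  by case: p => a b /= h1 h2; congr pair; apply/funext.
split=> [[[Ar As At] unmixed] p|nbad].
  case=> [[h nA]|[h [A0 nA1]]|[h [A0 [A1 nA2]]]|h].
  - by apply: nA; rewrite (pairE (p 0) (p 0).1 (p 0).1) // => i; rewrite -h.
  - apply: nA1; rewrite (pairE (p 1) (p 0).2 (p 0).1).
    + by apply: As; rewrite -surjective_pairing.
    + by move=> i; case: (h i).
    + by move=> i; case: (h i).
  - apply: nA2; rewrite (pairE (p 2) (p 0).1 (p 1).2).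
    + apply: (At _ (p 0).2); first by rewrite -surjective_pairing.
      rewrite (_ : (p 0).2 = (p 1).1) -?surjective_pairing //.
      by apply/funext => i; case: (h i).
    + by move=> i; case: (h i).
    + by move=> i; case: (h i).
  - apply: (unmixed (range p)); split; first by exists (p 0), 0.
    move=> _ n [i _ <-]; have [[k [Ak /agreeE ik]] [m [Am /agreeE im]]] := h i n.
    by split; [exists (p k)|exists (p m)]; split=> //.
split; last first.
  move=> F /mixed_range[q [_ mq]]; apply: (nbad q); apply: Or44 => i n.
  have [|[y [[k _ <-] Ak ik]] [z [[m _ <-] Am im]]] := mq (q i) n.
    by exists i.
  by split; [exists k|exists m]; split=> //; apply/agreeE.
split.
- move=> x; apply: contrapT => nA.
  by apply: (nbad (fun=> (x, x))); apply: Or41.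
- move=> x y Axy; apply: contrapT => nA.
  by apply: (nbad (fun j => if j is 0 then (x, y) else (y, x))); apply: Or42.
- move=> x y z Axy Ayz; apply: contrapT => nA.
  apply: (nbad (fun j => if j is 0 then (x, y) else
                         if j is 1 then (y, z) else (x, z))).
  exact: Or43.
Qed.

(** One sequence [z] stores countably many pairs of points and a valuation of the nodes for each
    pair; the tags 0, 1 and 2 separate the two coordinates and the valuations. *)
Definition point_of (z : baire_space) (j : nat) : cantor_space * cantor_space :=
  ((fun i => z (pickle (0, j, i)) != 0) : cantor_space,
   (fun i => z (pickle (1, j, i)) != 0) : cantor_space).

Definition bits_of (z : baire_space) (j : nat) (s : seq nat) : Prop :=
  (z (pickle (2, j, pickle s)) != 0) = true.

Lemma point_bits_of (p : nat -> cantor_space * cantor_space)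
    (v : nat -> seq nat -> Prop) :
  exists z, point_of z = p /\ bits_of z = v.
Proof.
exists (fun m => match unpickle m : option (nat * nat * nat) with
  | Some (0, j, i) => nat_of_bool ((p j).1 i)
  | Some (1, j, i) => nat_of_bool ((p j).2 i)
  | Some (_, j, i) =>
      if unpickle i is Some s then nat_of_bool `[< v j s >] else 0
  | None => 0 end); split.
  apply/funext => j; rewrite /point_of [p j]surjective_pairing.
  by congr pair; apply/funext => i; rewrite pickleK eqb0 negbK.
apply/funext => j; apply/funext => s; apply/propext.
rewrite /bits_of !pickleK eqb0 negbK.
by split=> [/asboolP|?] //; apply/asboolP.
Qed.

(** The witness is read either as an infinite branch or as points with valuations. The branch
    condition goes through lists [s], so that [code_node] is evaluated at fixed nodes. *)
Definition bad_code (w : cantor_space * baire_space) : Prop :=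
  [\/ ~ tree_code w.1,
      forall n, exists s, [/\ size s = n, forall i, i < n -> w.2 i = nth 0 s i &
        code_node w.1 s] |
      (forall j, evaluation w.1 (point_of w.2 j) (bits_of w.2 j)) /\
        bad_points (point_of w.2) (fun j => bits_of w.2 j [::])].

Lemma bad_codeP :
  ~` Pi02_learnable_codes B = [set c | exists z, bad_code (c, z)].
Proof.
have graphE t : graph (fun x y => coded_set B t (x, y)) = coded_set B t.
  by apply/seteqP; split=> -[x y].
have mk_branch (f : nat -> nat) n (s : seq nat) :
    size s = n -> (forall i, i < n -> f i = nth 0 s i) -> mkseq f n = s.
  move=> sn fs; apply: (@eq_from_nth _ 0); rewrite size_mkseq // => i lin.
  by rewrite nth_mkseq // fs.
apply/seteqP; split=> [c ncode|c [z bad] [t [ct bt [Erel EG El]]]]; last first.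
  have [tt tlab twf] := bt.
  case: bad => [|/= hz|/= [hev hbad]].
  - by apply; apply/tree_codeP; exists t.
  - apply: twf; exists z => n; have [s [sn zs cs]] := hz n.
    by rewrite (mk_branch z n s) //; exact/(code_nodeP _ ct).
  - have unmixed := (Gdelta_learnableP Erel).1; rewrite graphE in unmixed.
    have /bad_pointsP := conj Erel (unmixed (conj EG El)).
    move=> /(_ (point_of z)); apply; move: hbad; congr bad_points.
    by apply/funext => j; apply/propext; exact: evaluation_root.
apply: contrapT => /forallNP nbad; apply: ncode.
have /tree_codeP[t [ct tt tlab]] : tree_code c.
  by apply: contrapT => nc; apply: (nbad point); apply: Or31.
have twf : well_founded_tree t.
  move=> [f hf]; apply: (nbad f); apply: Or32 => n; exists (mkseq f n).
  split; first by rewrite size_mkseq.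
    by move=> i lin; rewrite nth_mkseq.
  exact/(code_nodeP _ ct).
have bt : borel_tree t by [].
exists t; split=> //=.
have [Erel unmixed] : equivalence_relation (fun x y => coded_set B t (x, y)) /\
    forall F, ~ mixed (coded_set B t) F.
  apply/bad_pointsP => p hp.
  have [z [pz vz]] := point_bits_of p (fun j s => node_set B t s (p j)).
  apply: (nbad z); apply: Or33; rewrite /= pz vz; split=> // j.
  exact: evaluation_node_set.
have := (Gdelta_learnableP Erel).2; rewrite graphE => /(_ unmixed)[EG El].
by split.
Qed.

(** * Complexity of bad codes *)

Lemma Delta11_bit (i : nat) (b : bool) :
  Delta11 (fun w : cantor_space * baire_space => w.1 i = b).
Proof.
apply: Delta11_clopen; split; last rewrite -openC;
  apply/open_agreeP => w wi; exists i.+1 => y [wy _] /=;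
  by rewrite -(wy i (ltnSn i)).
Qed.

Lemma Delta11_digit (i : nat) (P : nat -> Prop) :
  Delta11 (fun w : cantor_space * baire_space => P (w.2 i)).
Proof.
apply: Delta11_clopen; split; last rewrite -openC;
  apply/open_agreeP => w wi; exists i.+1 => y [_ wy] /=;
  by rewrite -(wy i (ltnSn i)).
Qed.

Lemma Delta11_code_node s :
  Delta11 (fun w : cantor_space * baire_space => code_node w.1 s).
Proof. by apply: Delta11_exists => a; exact: Delta11_bit. Qed.

Lemma Delta11_tree_code :
  Delta11 (fun w : cantor_space * baire_space => tree_code w.1).
Proof.
rewrite (_ : (fun w => _) = (fun w : cantor_space * baire_space =>
  (forall s a b, w.1 (entry_index s a) = true ->
     w.1 (entry_index s b) = true -> a = b) /\
  code_node w.1 [::] /\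
  (forall s n, code_node w.1 (rcons s n) -> code_node w.1 s) /\
  (forall s a, w.1 (entry_index s a) = true ->
     (exists n, code_node w.1 (rcons s n)) <-> a = Cup \/ a = Cap))); last first.
  by apply/funext => w; apply/propext; split=> [[]|[? [? [? ?]]]].
apply: Delta11_and.
  do 3 apply: Delta11_forall => ?.
  apply: Delta11_imp; first exact: Delta11_bit.
  by apply: Delta11_imp; [exact: Delta11_bit|exact: Delta11_cst].
apply: Delta11_and; first exact: Delta11_code_node.
apply: Delta11_and.
  do 2 apply: Delta11_forall => ?.
  by apply: Delta11_imp; exact: Delta11_code_node.
do 2 apply: Delta11_forall => ?.
apply: Delta11_imp; first exact: Delta11_bit.
apply: Delta11_iff; last exact: Delta11_cst.
by apply: Delta11_exists => n; exact: Delta11_code_node.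
Qed.

(** Splitting on the value of digit [i] leaves conditions on single digits. *)
Lemma Delta11_digit2 (i j : nat) (P : nat -> nat -> Prop) :
  Delta11 (fun w : cantor_space * baire_space => P (w.2 i) (w.2 j)).
Proof.
rewrite (_ : (fun w => _) = (fun w : cantor_space * baire_space =>
  exists m, P m (w.2 j) /\ w.2 i = m)); last first.
  by apply/funext => w; apply/propext; split=> [|[m [Pm ->]]]; [exists (w.2 i)|].
apply: Delta11_exists => m; apply: Delta11_and.
  exact: (@Delta11_digit j (P m)).
exact: (@Delta11_digit i (fun k => k = m)).
Qed.

Lemma Delta11_agree_points i k n :
  Delta11 (fun w : cantor_space * baire_space => forall j, j < n ->
    (point_of w.2 i).1 j = (point_of w.2 k).1 j /\
    (point_of w.2 i).2 j = (point_of w.2 k).2 j).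
Proof.
apply: Delta11_forall => j; apply: Delta11_imp; first exact: Delta11_cst.
by apply: Delta11_and; exact: (@Delta11_digit2 _ _ (fun a b => (a != 0) = (b != 0))).
Qed.

Lemma Delta11_bits_of j s :
  Delta11 (fun w : cantor_space * baire_space => bits_of w.2 j s).
Proof. exact: (@Delta11_digit _ (fun a => (a != 0) = true)). Qed.

Lemma Delta11_bad_points :
  Delta11 (fun w : cantor_space * baire_space =>
    bad_points (point_of w.2) (fun j => bits_of w.2 j [::])).
Proof.
rewrite /bad_points.
rewrite (_ : (fun w => _) = (fun w : cantor_space * baire_space =>
  ((forall i, (point_of w.2 0).1 i = (point_of w.2 0).2 i) /\
      ~ bits_of w.2 0 [::]) \/
  ((forall i, (point_of w.2 0).1 i = (point_of w.2 1).2 i /\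
      (point_of w.2 0).2 i = (point_of w.2 1).1 i) /\
      bits_of w.2 0 [::] /\ ~ bits_of w.2 1 [::]) \/
  ((forall i, (point_of w.2 0).1 i = (point_of w.2 2).1 i /\
      (point_of w.2 0).2 i = (point_of w.2 1).1 i /\
      (point_of w.2 1).2 i = (point_of w.2 2).2 i) /\
      bits_of w.2 0 [::] /\ bits_of w.2 1 [::] /\ ~ bits_of w.2 2 [::]) \/
  (forall i n,
      (exists k, bits_of w.2 k [::] /\ forall j, j < n ->
         (point_of w.2 i).1 j = (point_of w.2 k).1 j /\
         (point_of w.2 i).2 j = (point_of w.2 k).2 j) /\
      (exists k, ~ bits_of w.2 k [::] /\ forall j, j < n ->
         (point_of w.2 i).1 j = (point_of w.2 k).1 j /\
         (point_of w.2 i).2 j = (point_of w.2 k).2 j)))); last first.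
  apply/funext => w; apply/propext; split=> [[?|?|[h ?]|?]|[?|[?|[[h ?]|?]]]].
  - by left.
  - by right; left.
  - by right; right; left; split=> // i; case: (h i).
  - by right; right; right.
  - exact: Or41.
  - exact: Or42.
  - by apply: Or43; split=> // i; case: (h i) => ? [? ?].
  - exact: Or44.
have Dcoord i j k l (a b : bool) : Delta11 (fun w : cantor_space * baire_space =>
  (if a then (point_of w.2 i).1 else (point_of w.2 i).2) j =
  (if b then (point_of w.2 k).1 else (point_of w.2 k).2) l).
  by case: a; case: b; exact: (@Delta11_digit2 _ _ (fun a b => (a != 0) = (b != 0))).
apply: Delta11_or; [|apply: Delta11_or; [|apply: Delta11_or]].
- apply: Delta11_and; last exact/Delta11_not/Delta11_bits_of.
  by apply: Delta11_forall => i; exact: (Dcoord _ _ _ _ true false).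
- apply: Delta11_and; last apply: Delta11_and.
  + apply: Delta11_forall => i; apply: Delta11_and.
      exact: (Dcoord _ _ _ _ true false).
    exact: (Dcoord _ _ _ _ false true).
  + exact: Delta11_bits_of.
  + exact/Delta11_not/Delta11_bits_of.
- apply: Delta11_and; last apply: Delta11_and; last apply: Delta11_and.
  + apply: Delta11_forall => i; apply: Delta11_and; last apply: Delta11_and.
    * exact: (Dcoord _ _ _ _ true true).
    * exact: (Dcoord _ _ _ _ false true).
    * exact: (Dcoord _ _ _ _ false false).
  + exact: Delta11_bits_of.
  + exact: Delta11_bits_of.
  + exact/Delta11_not/Delta11_bits_of.
- do 2 apply: Delta11_forall => ?; apply: Delta11_and.
    apply: Delta11_exists => k; apply: Delta11_and; first exact: Delta11_bits_of.
    exact: Delta11_agree_points.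
  apply: Delta11_exists => k; apply: Delta11_and.
    exact/Delta11_not/Delta11_bits_of.
  exact: Delta11_agree_points.
Qed.

(** An open set is a countable union of balls around dense points, and lying in a ball is a
    condition on finitely many digits. *)
Lemma Delta11_open (U : set (cantor_space * cantor_space)) j : open U ->
  Delta11 (fun w : cantor_space * baire_space => U (point_of w.2 j)).
Proof.
move=> oU; have [e he] := @agree_dense (cantor_space * cantor_space)%type _.
rewrite (_ : (fun w => _) = (fun w : cantor_space * baire_space =>
  exists n m, (forall q, agree n (e m) q -> U q) /\
    forall i, i < n -> (point_of w.2 j).1 i = (e m).1 i /\
                       (point_of w.2 j).2 i = (e m).2 i)); last first.
  apply/funext => w; apply/propext; split=> [Uw|[n [m [hU h]]]].
    have [n nU] := (open_agreeP _).1 oU _ Uw.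
    have [m hm] := he n (point_of w.2 j).
    exists n, m; split=> [q mq|i lin]; first by apply: nU; exact: agree_trans hm mq.
    by case: hm => h1 h2; split; [exact: h1|exact: h2].
  by apply: hU; split=> i /h[].
apply: Delta11_exists => n; apply: Delta11_exists => m.
apply: Delta11_and; first exact: Delta11_cst.
apply: Delta11_forall => i; apply: Delta11_imp; first exact: Delta11_cst.
apply: Delta11_and; first exact: (@Delta11_digit _ (fun a => (a != 0) = (e m).1 i)).
exact: (@Delta11_digit _ (fun a => (a != 0) = (e m).2 i)).
Qed.

Lemma Pi11_codes : (forall k, open (B k)) -> Pi11 (Pi02_learnable_codes B).
Proof.
move=> oB; rewrite /Pi11 bad_codeP; apply: Sigma11_proj.
suff [] : Delta11 bad_code by [].
rewrite (_ : bad_code = (fun w : cantor_space * baire_space =>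
  ~ tree_code w.1 \/
  (forall n, exists s, size s = n /\
     (forall i, i < n -> w.2 i = nth 0 s i) /\ code_node w.1 s) \/
  ((forall j s a, w.1 (entry_index s a) = true ->
    (bits_of w.2 j s <-> match a with
      | Cup => exists n, code_node w.1 (rcons s n) /\ bits_of w.2 j (rcons s n)
      | Cap => forall n, code_node w.1 (rcons s n) -> bits_of w.2 j (rcons s n)
      | Basic k => B k (point_of w.2 j)
      end)) /\
   bad_points (point_of w.2) (fun j => bits_of w.2 j [::])))); last first.
  apply/funext => w; apply/propext; split=> [[?|h|?]|[?|[h|?]]].
  - by left.
  - by right; left=> n; have [s []] := h n; exists s.
  - by right; right.
  - exact: Or31.
  - by apply: Or32 => n; have [s [? []]] := h n; exists s.
  - exact: Or33.
apply: Delta11_or; last apply: Delta11_or; last apply: Delta11_and.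
- exact/Delta11_not/Delta11_tree_code.
- apply: Delta11_forall => n; apply: Delta11_exists => s.
  apply: Delta11_and; first exact: Delta11_cst.
  apply: Delta11_and; last exact: Delta11_code_node.
  apply: Delta11_forall => i; apply: Delta11_imp; first exact: Delta11_cst.
  exact: (@Delta11_digit i (fun a => a = nth 0 s i)).
- apply: Delta11_forall => j; apply: Delta11_forall => s.
  apply: Delta11_forall => a.
  apply: Delta11_imp; first exact: Delta11_bit.
  apply: Delta11_iff; first exact: Delta11_bits_of.
  case: a => [||k].
  + apply: Delta11_exists => n; apply: Delta11_and.
      exact: Delta11_code_node.
    exact: Delta11_bits_of.
  + apply: Delta11_forall => n; apply: Delta11_imp.
      exact: Delta11_code_node.
    exact: Delta11_bits_of.
  + exact: Delta11_open.
- exact: Delta11_bad_points.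
Qed.

End Codes.

(** * Hardness *)

Definition clopen_basis_seq (X : topologicalType) (V : nat -> set X) : Prop :=
  (forall k, clopen (V k)) /\
  forall x U, nbhs x U -> exists2 k, V k x & V k `<=` U.

(** Balls around dense points form a countable base. For each two of them with a clopen set in
    between, one such clopen set is chosen. *)
Lemma polish_clopen_basis_seq (R : realType) (X : topologicalType) :
  polish R X -> has_clopen_base X -> exists V : nat -> set X, clopen_basis_seq V.
Proof.
move=> [[D cD dD] [d [[d_ge0 d0 d_sym d_tri] dmet _]]] [_ base].
have /countable_injP[f finj] := cD.
(* The center is indexed through the injection [f] of [D] into the numbers; the radius is the
   inverse of [w.2.+1]. *)
pose W (w : nat * nat) : set X :=
  [set y | exists2 a, D a /\ f a = w.1 & (d a y < w.2.+1%:R^-1)%R].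
have nbhsW w x : W w x -> nbhs x (W w).
  move=> [a aw ax]; apply/dmet; exists (w.2.+1%:R^-1 - d a x)%R.
    by rewrite subr_gt0.
  move=> y /= xy; exists a => //; apply: le_lt_trans (d_tri a x y) _.
  by rewrite addrC -ltrBrDr.
have baseW x U : nbhs x U -> exists2 w, W w x & W w `<=` U.
  move=> /dmet[e e0 eU].
  have [k] : exists k, (0 + k.+1%:R^-1 < e / 2)%R.
    by apply: ltr_add_invr; rewrite divr_gt0.
  rewrite add0r => ke.
  have k0 : (0 < k.+1%:R^-1 :> R)%R by rewrite invr_gt0.
  pose O := interior [set y | (d x y < k.+1%:R^-1)%R].
  have Ox : O x by apply/dmet; exists (k.+1%:R^-1)%R.
  have [a [Oa Da]] : (O `&` D) !=set0.
    by apply: dD; [exists x|exact: open_interior].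
  have xa : (d x a < k.+1%:R^-1)%R by exact: (interior_subset Oa).
  exists (f a, k); first by exists a => //=; rewrite d_sym.
  move=> y [b [Db fb] by_]; apply: eU => /=.
  have ab : b = a by apply: finj => //; rewrite inE.
  rewrite {}ab in by_; apply: le_lt_trans (d_tri x a y) _.
  by rewrite [e]splitr; apply: ltrD; [exact: lt_trans xa ke|exact: lt_trans by_ ke].
have [V hV] : {V : (nat * nat) * (nat * nat) -> set X & forall ij,
    clopen (V ij) /\
    ((exists2 C, clopen C & W ij.1 `<=` C /\ C `<=` W ij.2) ->
     W ij.1 `<=` V ij /\ V ij `<=` W ij.2)}.
  apply: (@choice _ _ (fun ij (v : set X) => clopen v /\
    ((exists2 C, clopen C & W ij.1 `<=` C /\ C `<=` W ij.2) ->
     W ij.1 `<=` v /\ v `<=` W ij.2))) => ij.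
  have [[C ? ?]|nC] :=
    pselect (exists2 C, clopen C & W ij.1 `<=` C /\ C `<=` W ij.2).
    by exists C.
  by exists setT; split=> //; split; [exact: openT|exact: closedT].
exists (fun k => if unpickle k is Some ij then V ij else setT); split.
  move=> k; case: unpickle => [ij|]; first by case: (hV ij).
  by split; [exact: openT|exact: closedT].
move=> x U /baseW[j Wj jU].
have [C [cC Cx] Cj] := base x _ (nbhsW _ _ Wj).
have [i Wi iC] : exists2 w, W w x & W w `<=` C.
  by apply: baseW; apply: open_nbhs_nbhs; split=> //; case: cC.
have [_ [|iV Vj]] := hV (i, j); first by exists C.
exists (pickle (i, j)); rewrite pickleK; first exact: iV.
exact: subset_trans Vj jU.
Qed.

(** * The reduction *)

Section Hardness.
Context (X : topologicalType) (V : nat -> set X).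
Hypothesis hV : clopen_basis_seq V.
Variable C : set (X * baire_space).
Hypothesis cC : closed C.
Implicit Types (x y : X) (s u : seq nat).

(** The tree of attempts to find [z] with [C (x, z)]. Only the bits [V k x] with [k < size s] enter,
    which makes the tree depend continuously on [x]. *)
Definition section_tree x s : Prop := exists y z,
  [/\ C (y, z), forall k, k < size s -> V k y <-> V k x &
      forall i, i < size s -> z i = nth 0 s i].

(** Along an infinite branch [f], the points of [C] attached to its nodes converge to [(x, f)],
    which lies in [C] as [C] is closed. *)
Lemma section_treeP x :
  (exists z, C (x, z)) <-> exists f, forall n, section_tree x (mkseq f n).
Proof.
split=> [[z Cz]|[f hf]].
  exists z => n; exists x, z; split=> // i; rewrite size_mkseq => lin.
  by rewrite nth_mkseq.
exists f; apply: contrapT => nC.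
have [[P Q] [/= Px Qf] PQ] : nbhs (x, f : baire_space) (~` C).
  by apply: open_nbhs_nbhs; split=> //; exact: closed_openC.
have [k Vk kP] := hV.2 x P Px.
have /agree_nbhs[n nQ] := Qf.
have [y [z [Cyz Vy zf]]] := hf (maxn k.+1 n).
rewrite size_mkseq in Vy zf; apply: (PQ (y, z)) Cyz; split=> /=.
  by apply: kP; apply/Vy; rewrite // leq_max ltnSn.
apply: nQ => i lin.
by rewrite /= zf ?nth_mkseq // leq_max lin orbT.
Qed.

Lemma section_tree_prefix x s n :
  section_tree x (rcons s n) -> section_tree x s.
Proof.
move=> [y [z [Cyz Vy zs]]]; exists y, z; rewrite size_rcons in Vy zs.
split=> // i lis; first by apply: Vy; exact: leqW.
by rewrite zs ?leqW // nth_rcons lis.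
Qed.

(** The entry [i] of [section_tree] becomes [i.*2.+1]. The case [nilp u] keeps the root even if
    [section_tree x] is empty. *)
Definition spine x u : bool :=
  all odd u && (nilp u || `[< section_tree x (map half u) >]).

Lemma spine_prefix x u n : spine x (rcons u n) -> spine x u.
Proof.
rewrite /spine all_rcons => /andP[/andP[_ ->]] /=.
rewrite /nilp size_rcons /= map_rcons => /asboolP/section_tree_prefix h.
by apply/orP; right; apply/asboolP.
Qed.

(* The nodes over [section_tree x] use odd entries and are unions; each of them
   gets all the basic sets as additional children, at the even entries. So the
   coded set is the whole space, and only well-foundedness depends on [x]. *)
Definition wadge_tree x : labeled_tree := fun u =>
  if spine x u then Some Cup else
  if rev u is n :: r then
    if ~~ odd n && spine x (rev r) then Some (Basic n./2) else None
  else None.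

Lemma wadge_tree_rcons x u n : wadge_tree x (rcons u n) =
  if spine x (rcons u n) then Some Cup else
  if ~~ odd n && spine x u then Some (Basic n./2) else None.
Proof. by rewrite /wadge_tree rev_rcons revK. Qed.

Lemma wadge_tree_spine x u : spine x u -> wadge_tree x u = Some Cup.
Proof. by rewrite /wadge_tree => ->. Qed.

Lemma wadge_node_parent x u n : node (wadge_tree x) (rcons u n) -> spine x u.
Proof.
rewrite /node wadge_tree_rcons; case: ifP => [/spine_prefix //|_].
by case: ifP => // /andP[].
Qed.

Lemma wadge_tree_even x u k :
  spine x u -> wadge_tree x (rcons u k.*2) = Some (Basic k).
Proof.
move=> ux; rewrite wadge_tree_rcons {1}/spine all_rcons odd_double /=.
by rewrite ux doubleK.
Qed.

Lemma wadge_tree_is_tree x : is_tree (wadge_tree x).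
Proof.
split; first by rewrite /node wadge_tree_spine.
by move=> s n /wadge_node_parent sx; rewrite /node wadge_tree_spine.
Qed.

Lemma wadge_tree_well_labeled x : well_labeled (wadge_tree x).
Proof.
move=> s a sa; have [sx|nsx] := boolP (spine x s).
  move: sa; rewrite wadge_tree_spine // => -[<-]; split=> _; first by left.
  by exists 0; rewrite /node (@wadge_tree_even x s 0).
split=> [[n /wadge_node_parent]|]; first by rewrite (negbTE nsx).
move: sa; rewrite /wadge_tree (negbTE nsx); case: (rev s) => // n r.
by case: ifP => // _ [<-] [].
Qed.

(** Basic leaves have no children, so an infinite branch stays in the spine, and halving its entries
    gives a branch of [section_tree x]. *)
Lemma wadge_tree_wf x :
  well_founded_tree (wadge_tree x) <-> ~ exists z, C (x, z).
Proof.
rewrite section_treeP /well_founded_tree; split; apply: contra_not.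
  move=> [f hf]; exists (fun i => (f i).*2.+1) => n.
  rewrite /node wadge_tree_spine // /spine.
  have -> : map half (mkseq (fun i => (f i).*2.+1) n) = mkseq f n.
    rewrite /mkseq -map_comp; apply: eq_map => i /=.
    by rewrite uphalf_double.
  apply/andP; split; last by apply/orP; right; apply/asboolP.
  by apply/allP => _ /mapP[i _ ->] /=; rewrite odd_double.
move=> [f hf]; exists (fun i => (f i)./2) => n.
(* Length [n.+1] excludes the root, which is in the spine by default. *)
have : spine x (mkseq f n.+1).
  by apply: (@wadge_node_parent x _ (f n.+1)); rewrite -mkseqS.
rewrite /spine /nilp size_mkseq => /andP[_ /orP[//|/asboolP]].
rewrite mkseqS map_rcons => /section_tree_prefix.
by rewrite /mkseq -map_comp.
Qed.

Lemma wadge_tree_coded (B : nat -> set (cantor_space * cantor_space)) x :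
  (forall p, exists k, B k p) -> coded_set B (wadge_tree x) = setT.
Proof.
move=> Bcover; apply/seteqP; split=> // p _; have [k Bp] := Bcover p.
have := @wadge_tree_even x [::] k isT.
move=> tk; apply: (@node_set_cup _ _ _ [::] k.*2) => //; rewrite ?/node ?tk //.
by apply: node_set_basic Bp; rewrite tk.
Qed.

Definition wadge_code x : cantor_space := fun i =>
  `[< exists s a, entry_index s a = i /\ wadge_tree x s = Some a >].

Lemma wadge_code_codes x : codes_tree (wadge_code x) (wadge_tree x).
Proof.
move=> s a; split=> [/asboolP[s' [a' [e]]]|sa]; last first.
  by apply/asboolP; exists s, a.
have := @bij_inj _ _ _ entry_index_bij (s', a') (s, a) e.
by move=> [-> ->].
Qed.

(** Bit [i] concerns one node, whose label depends on finitely many bits [V k x]; these are locally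
    constant because the [V k] are clopen. *)
Lemma wadge_code_continuous : continuous wadge_code.
Proof.
have near_V x m : nbhs x [set y | forall k, k < m -> V k y <-> V k x].
  elim: m => [|m IHm]; first exact: filterS filterT.
  have xm : nbhs x [set y | V m y <-> V m x].
    have [oV cV] := hV.1 m; have [Vx|nVx] := pselect (V m x).
      apply: filterS (open_nbhs_nbhs (conj oV Vx)) => y Vy; by split.
    apply: filterS (open_nbhs_nbhs (conj (closed_openC cV) nVx)) => y nVy.
    by split.
  apply: filterS (filterI IHm xm) => y [ym ymm] k.
  by rewrite ltnS leq_eqVlt => /orP[/eqP->|/ym].
have treeE x y m s : (forall k, k < m -> V k y <-> V k x) -> size s <= m ->
    wadge_tree y s = wadge_tree x s.
  move=> yx; have secE u : size u <= m -> section_tree y u = section_tree x u.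
    move=> um; apply/propext; split=> -[y' [z [Cz Vz zu]]];
      exists y', z; split=> // k ku.
      by rewrite Vz // yx // (leq_trans ku).
    by rewrite Vz // yx // (leq_trans ku).
  have spineE u : size u <= m -> spine y u = spine x u.
    by move=> um; rewrite /spine secE // size_map.
  case/lastP: s => [|s n sm]; first by rewrite /wadge_tree spineE.
  rewrite !wadge_tree_rcons !spineE //.
  by move: sm; rewrite size_rcons => /ltnW.
move=> x U /agree_nbhs[n nU].
suff : nbhs x [set y | forall i, i < n -> wadge_code x i = wadge_code y i].
  by apply: filterS => y; exact: nU.
elim: n {nU} => [|n IHn]; first exact: filterS filterT.
have [g _ gK] := entry_index_bij.
apply: filterS (filterI IHn (near_V x (size (g n).1))) => y [yn yV] i.
rewrite ltnS leq_eqVlt => /orP[/eqP->|/yn //]; rewrite -(gK n).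
have [cx cy] := (wadge_code_codes x, wadge_code_codes y).
apply/idP/idP => [/cx h|/cy h]; first by apply/cy; rewrite (treeE x y _ _ yV).
by apply/cx; rewrite -(treeE x y _ _ yV).
Qed.

End Hardness.

(** * Subbases and conclusion *)

Lemma subbase_open (X : topologicalType) (B : nat -> set X) k :
  subbase B -> open (B k).
Proof.
move=> [+ _]; apply; exists (finmap.fset1 k); first by move=> i _; rewrite inE.
apply/seteqP; split=> [x h|x Bx i /=]; last by move=> /finmap.fset1P ->.
by apply: h; exact/finmap.fset1P.
Qed.

(** For a point in no [B k], the only finite intersection around it would be the whole space, yet it
    has a smaller neighborhood. *)
Lemma subbase_cover (B : nat -> set (cantor_space * cantor_space)) p :
  subbase B -> exists k, B k p.
Proof.
move=> [_ /(_ p)] base.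
have [W [[D _ DW] Wp] Wq] : exists2 W, finI_from [set: nat] B W /\ W p &
    W `<=` [set q | agree 1 p q].
  by apply: base; apply/agree_nbhs; exists 1.
apply: contrapT => noB.
have WT : W = setT.
  rewrite -DW; apply/seteqP; split=> // q _ i iD; case: noB.
  by exists i; move: Wp; rewrite -DW; apply.
pose q : cantor_space * cantor_space := ((fun i => ~~ p.1 i) : cantor_space, p.2).
have [+ _] : agree 1 p q by apply: Wq; rewrite WT.
by move=> /(_ 0 isT) /=; case: (p.1 0).
Qed.

Theorem theorem3p3 (R : realType) (B : nat -> set (cantor_space * cantor_space))
    (hB : subbase B) :
  Pi11_complete R (Pi02_learnable_codes B).
Proof.
split; first by apply: Pi11_codes => k; exact: subbase_open.
move=> X pX cX A [C cC AC].
have [V hV] := polish_clopen_basis_seq pX cX.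
have AE x : A x <-> ~ exists z, C (x, z).
  rewrite -[A]setCK AC; split; apply: contra_not.
    by move=> [z Cxz]; exists (x, z).
  move=> [[y z] Cyz /= <-].
  by exists z.
exists (@wadge_code X V C); first exact: wadge_code_continuous.
move=> x; rewrite AE -(wadge_tree_wf hV cC); split=> [wf|[t [ct [_ _ twf] _]]].
  exists (wadge_tree V C x); split; first exact: wadge_code_codes.
    split=> //; [exact: wadge_tree_is_tree|exact: wadge_tree_well_labeled].
  have -> : coded_set B (wadge_tree V C x) = setT.
    by apply: wadge_tree_coded => p; exact: subbase_cover.
  split=> //; first exact: open_Gdelta openT.
  (* For the total relation every answer is correct. *)
  exists (fun _ _ => 0) => [n|y ys _]; first exact: cst_continuous.
  by exists 0 => //; exact: cvg_cst.
(* A code determines its tree, so the well-foundedness of [t] carries over. *)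
suff <- : t = wadge_tree V C x by [].
apply/funext => s.
have E a : t s = Some a <-> wadge_tree V C x s = Some a.
  by rewrite -(ct s a) -(wadge_code_codes V C x s a).
case e: (t s) => [a|]; first by rewrite ((E a).1 e).
by case e': (wadge_tree V C x s) => [a|] //; rewrite ((E a).2 e') in e.
Qed.
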